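(* Assume $U''(s)>0$ for a.e. $s\in(0,\alpha)$ and $M\in(0,\alpha|\Omega|)$. Define $$\widehat\rho^{(0)}(x):=T_{0,\alpha}\circ(U')^{-1}(C_0-V(x)),\quad x\in\Omega,$$ where $C_0$ is uniquely determined by the mass condition $\int_\Omega T_{0,\alpha}\circ(U')^{-1}(C_0-V)=M$. Then: (i) $S_t\widehat\rho^{(0)}=\widehat\rho^{(0)}$ for any $t>0$. (ii) $\widehat\rho^{(0)}$ is the unique $L^1$-local minimiser of the free energy $\mathcal F$ over $\mathcal A_M$. It is the unique global minimiser over $\mathcal A_M$. (iii) If moreover $\inf_{s\in(0,\alpha)}U''(s)>0$, then $\widehat\rho^{(0)}$ is the limit as $\varepsilon\to0$ of the constant-in-time weak solutions $\widehat\rho^{(\varepsilon)}:=(U_\varepsilon')^{-1}(C_\varepsilon-V)$ of $(P_\varepsilon)$, where $C_\varepsilon$ is uniquely determined by $\int_\Omega(U_\varepsilon')^{-1}(C_\varepsilon-V)=M$: $$\widehat\rho^{(\varepsilon)}\to\widehat\rho^{(0)}\quad\text{in }L^1(\Omega)\text{ as }\varepsilon\to0.$$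
   Context: Setting. $\Omega\subset\mathbb R^d$ is a bounded, connected, smooth domain with outer normal $\nu$. Standing assumptions: (1) $\alpha\in(0,\infty)$, $\mathrm m\in C([0,\alpha])\cap C^1((0,\alpha))$, $\mathrm m(0)=\mathrm m(\alpha)=0$, $\mathrm m>0$ on $(0,\alpha)$; (2) $V\in C^2(\overline\Omega)$, $V\ge0$; (3) $U\in W^{1,1}((0,\alpha))\cap C^3((0,\alpha))$, $U''\ge0$, and $s_0\in(0,\alpha)$ is a fixed point with $U''(s_0)>0$; (4) $\mathrm m U''\in L^1(0,\alpha)$ and, with $\Phi(s):=\int_{s_0}^s\mathrm m(\tau)U''(\tau)\,d\tau$, one has $\Phi(0)<\Phi(s)<\Phi(\alpha)$ for $s\in(0,\alpha)$ and $$\sup_{s\in[0,\alpha]}\left|\tfrac{(\Phi(\alpha)-\Phi(s))\Phi(s)}{\Phi'(s)}\right|+\left|\tfrac{(\Phi(s)-\Phi(0))\Phi(s)}{\Phi'(s)}\right|<\infty .$$ Notation: $\mathcal A=\{\rho\in L^1(\Omega):0\le\rho\le\alpha\}$; $\mathcal A_+=\{\rho\in L^1(\Omega):\exists\delta>0,\ \delta\le\rho\le\alpha-\delta\}$; $\mathcal A_M=\{\rho\in\mathcal A:\|\rho\|_{L^1(\Omega)}=M\}$; $\mathcal F[\rho]=\int_\Omega U(\rho)\,dx+\int_\Omega V\rho\,dx$. With $\underline\zeta:=U'(0^+)$, $\overline\zeta:=U'(\alpha^-)$ (possibly infinite), $T_{0,\alpha}\circ(U')^{-1}(\zeta)$ equals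 $\alpha$ if $\zeta\ge\overline\zeta$, $(U')^{-1}(\zeta)$ if $\zeta\in(\underline\zeta,\overline\zeta)$, and $0$ if $\zeta\le\underline\zeta$. Problem $(P)$: $\partial_t\rho=\operatorname{div}(\mathrm m(\rho)\nabla(U'(\rho)+V))$ in $(0,\infty)\times\Omega$, $\mathrm m(\rho)\nabla(U'(\rho)+V)\cdot\nu=0$ on $(0,\infty)\times\partial\Omega$, $\rho(0,\cdot)=\rho_0\in\mathcal A$. Regularisation, $\varepsilon\in(0,1]$. $\kappa(\varepsilon)>0$ with $\kappa(\varepsilon)\to0$ as $\varepsilon\to0$. $\Phi_\varepsilon\in C^3([0,\alpha])$ satisfies $g_\varepsilon\le\Phi_\varepsilon'\le(1+\varepsilon)g_\varepsilon$, where $g_\varepsilon(s)=\min(\Phi'(s),\kappa(\varepsilon)^{-1})+\varepsilon$, $\Phi_\varepsilon(s_0)=0$, and $\Phi_\varepsilon\to\Phi$ in $C^2_{loc}((0,\alpha))$. $\mathrm m_\varepsilon\in C^1([0,\alpha])$ satisfies $\mathrm m_\varepsilon(0)=\mathrm m_\varepsilon(\alpha)=0$, $\mathrm m_\varepsilon>0$ in $(0,\alpha)$, $|\mathrm m_\varepsilon'|>1$ near $0$ and $\alpha$. $U_\varepsilon\in C^{3,1}((0,\alpha))$ is given by $U_\varepsilon''=\Phi_\varepsilon'/\mathrm m_\varepsilon$, $U_\varepsilon(\alpha/2)=U(\alpha/2)$, $U_\varepsilon'(\alpha/2)=U'(\alpha/2)$; consequently $U_\varepsilon':(0,\alpha)\to\mathbb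 R$ is a strictly increasing bijection. Moreover $\mathrm m_\varepsilon\to\mathrm m$ pointwise as $\varepsilon\to0$, $\sup_{\varepsilon\in(0,1)}\|U_\varepsilon'\|_{L^1((0,\alpha))}<\infty$, and $(\varepsilon,s)\mapsto\mathrm m_\varepsilon(s)$ (with $\mathrm m_0=\mathrm m$) belongs to $C([0,1]\times[0,\alpha])\cap C^\infty_{loc}((0,1]\times[0,\alpha])$. Problem $(P_\varepsilon)$ is $(P)$ with $(\mathrm m,U)$ replaced by $(\mathrm m_\varepsilon,U_\varepsilon)$. Semigroups: $S^{(\varepsilon)}_t:\mathcal A\to\mathcal A$ is the unique $L^1$-contractive $C_0$-semigroup on $\mathcal A$ extending the map sending $\rho_0\in\mathcal A_+\cap C^2(\overline\Omega)$ to the unique classical solution of $(P_\varepsilon)$. $S_t:\mathcal A\to\mathcal A$ is the semigroup of weak solutions of $(P)$ obtained as a limit along some sequence $\varepsilon_k\to0$: $S^{(\varepsilon_k)}\rho_0\to S\rho_0$ in $C_{loc}([0,\infty);L^1(\Omega))$ for all $\rho_0\in\mathcal A$. *)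

(* Defs.v *)
From HB Require Import structures.
From mathcomp Require Import all_boot all_order all_algebra.
From mathcomp Require Import all_classical all_reals all_analysis.

Set Implicit Arguments.
Unset Strict Implicit.
Unset Printing Implicit Defensive.

Import Order.TTheory GRing.Theory Num.Theory.
Import numFieldNormedType.Exports.

Local Open Scope ring_scope.
Local Open Scope classical_set_scope.

Section borel_rV.
(* R^d is 'rV[R]_d, with the product of the Borel sigma-algebras of R, which is
   the Borel sigma-algebra of R^d. *)
Context {R : realType} {n : nat}.

Definition rV_display : measure_display. Proof. by []. Qed.

Let coord (i : 'I_n) (x : 'rV[R]_n) : measurableTypeR R := x ord0 i.

Let rV_set0 : g_sigma_preimage coord set0.
Proof. exact: sigma_algebra0. Qed.

Let rV_setC A : g_sigma_preimage coord A -> g_sigma_preimage coord (~` A).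
Proof. exact: sigma_algebraC. Qed.

Let rV_bigcup (F : (set 'rV[R]_n)^nat) :
  (forall i, g_sigma_preimage coord (F i)) ->
  g_sigma_preimage coord (\bigcup_i F i).
Proof. exact: sigma_algebra_bigcup. Qed.

HB.instance Definition _ := @isMeasurable.Build rV_display 'rV[R]_n
  (g_sigma_preimage coord) rV_set0 rV_setC rV_bigcup.

Lemma measurable_coord (i : 'I_n) :
  measurable_fun [set: 'rV[R]_n] (fun x => x ord0 i : measurableTypeR R).
Proof.
move=> _ Y mY; rewrite setTI; apply: sub_sigma_algebra => /=.
rewrite -bigcup_seq/=; exists i => /=; first by rewrite mem_index_enum.
by exists Y => //; rewrite setTI.
Qed.

Lemma measurable_fun_rV d (T : measurableType d) (f : T -> 'rV[R]_n) :
  (forall i, measurable_fun setT (fun t => f t ord0 i : measurableTypeR R)) ->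
  measurable_fun setT f.
Proof.
move=> mf _ A mA; rewrite setTI.
pose G := [set B : set 'rV[R]_n | measurable (f @^-1` B)].
suff: G A by [].
move: A mA; apply: smallest_sub.
  split.
  - rewrite /G/= preimage_set0; exact: measurable0.
  - move=> B GB; rewrite /G/= setTD preimage_setC; exact: measurableC.
  - move=> F GF; rewrite /G/= preimage_bigcup.
    by apply: bigcup_measurable => k _; exact: GF.
rewrite -bigcup_seq => B [i _ [C mC <-]]; rewrite setTI /G/=.
by rewrite -[X in measurable X]setTI; exact: mf.
Qed.

End borel_rV.

Section lebesgue_rV.
Context {R : realType}.

Definition rV_cons n (p : measurableTypeR R * 'rV[R]_n) : 'rV[R]_n.+1 :=
  \row_i oapp (fun j => p.2 ord0 j) p.1 (unlift ord0 i).

Definition rV_uncons n (x : 'rV[R]_n.+1) : measurableTypeR R * 'rV[R]_n :=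
  (x ord0 ord0, \row_j x ord0 (lift ord0 j)).

Lemma rV_consK n : cancel (@rV_cons n) (@rV_uncons n).
Proof.
case=> a x; rewrite /rV_cons /rV_uncons mxE unlift_none/=; congr pair.
by apply/rowP => j; rewrite !mxE liftK.
Qed.

Lemma rV_unconsK n : cancel (@rV_uncons n) (@rV_cons n).
Proof.
move=> x; apply/rowP => i; rewrite mxE.
by case: unliftP => [j ->|->]//=; rewrite mxE.
Qed.

Lemma measurable_rV_cons n : measurable_fun setT (@rV_cons n).
Proof.
apply: measurable_fun_rV => i; rewrite /rV_cons.
under eq_fun do rewrite mxE.
case: unliftP => [j _|_]/=; last exact: measurable_fst.
exact: (measurableT_comp (measurable_coord j) measurable_snd).
Qed.

Lemma measurable_rV_uncons n : measurable_fun setT (@rV_uncons n).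
Proof.
apply: measurable_fun_pair; first exact: measurable_coord.
apply: measurable_fun_rV => j.
rewrite /=; under eq_fun do rewrite mxE.
exact: measurable_coord.
Qed.

Section step.
Variables (n : nat) (mu : {sigma_finite_measure set 'rV[R]_n -> \bar R}).

Definition lebesgue_rV_step : set 'rV[R]_n.+1 -> \bar R :=
  pushforward (lebesgue_measure \x mu)%E (@rV_cons n).

Let step0 : lebesgue_rV_step set0 = 0%E.
Proof. by rewrite /lebesgue_rV_step/pushforward preimage_set0 measure0. Qed.

Let step_ge0 A : (0 <= lebesgue_rV_step A)%E.
Proof.
rewrite /lebesgue_rV_step/pushforward; apply: integral_ge0 => x _.
exact: measure_ge0.
Qed.

Let step_sigma_additive : semi_sigma_additive lebesgue_rV_step.
Proof.
move=> F mF tF mUF; rewrite /lebesgue_rV_step/pushforward preimage_bigcup.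
have mc := @measurable_rV_cons n.
apply: measure_semi_sigma_additive.
- by move=> k; rewrite -[X in measurable X]setTI; exact: mc.
- apply/trivIsetP => /= i j _ _ ij; rewrite -preimage_setI.
  by move/trivIsetP : tF => /(_ _ _ _ _ ij) ->//; rewrite preimage_set0.
- by rewrite -preimage_bigcup -[X in measurable X]setTI; exact: mc.
Qed.

HB.instance Definition _ := isMeasure.Build _ _ _ lebesgue_rV_step
  step0 step_ge0 step_sigma_additive.

Let step_sigma_finite : sigma_finite setT lebesgue_rV_step.
Proof.
have /sigma_finiteP[F [TF ndF Foo]] := sigma_finiteT (@lebesgue_measure R).
have /sigma_finiteP[G [TG ndG Goo]] := sigma_finiteT mu.
exists (fun k => @rV_uncons n @^-1` (F k `*` G k)).
  rewrite -preimage_bigcup -(preimage_setT (@rV_uncons n)); congr preimage.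
  rewrite -setXTT TF TG predeqE => -[x y]; split.
    move=> [/= [k _ Fkx] [l _ Gly]]; exists (maxn k l) => //; split.
    - by move: x Fkx; exact/subsetPset/ndF/leq_maxl.
    - by move: y Gly; exact/subsetPset/ndG/leq_maxr.
  by move=> [k _ []/= ? ?]; split; exists k.
move=> k; have [mFk Fkoo] := Foo k; have [mGk Gkoo] := Goo k; split.
  rewrite -[X in measurable X]setTI; apply: measurable_rV_uncons => //.
  exact: measurableX.
rewrite /lebesgue_rV_step /pushforward -comp_preimage.
rewrite (_ : _ \o _ = id) ?preimage_id//; last first.
  by apply/funext => p /=; rewrite rV_consK.
by rewrite product_measure1E// lte_mul_pinfty// ge0_fin_numE.
Qed.

HB.instance Definition _ := Measure_isSigmaFinite.Build _ _ _ lebesgue_rV_step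
  step_sigma_finite.

End step.

(* d-dimensional Lebesgue measure as the d-fold product of the measure on R. *)
Fixpoint lebesgue_rV n : {sigma_finite_measure set 'rV[R]_n -> \bar R} :=
  if n is k.+1 then lebesgue_rV_step (lebesgue_rV k)
  else dirac (0 : 'rV[R]_0).

End lebesgue_rV.

Section Ck_spaces.
Context {R : realType} {E : normedModType R}.

(* For O open and O `<=` K `<=` closure O: f is continuous on K, and its
   iterated derivatives of order at most k along the directions in D exist on
   O and have continuous extensions (the functions g) to K.  With D = setT,
   K = O gives C^k(O) and K = closure O gives C^k of the closure; proper
   choices of D give anisotropic spaces such as C^{1,2}. *)
Fixpoint Ck_along (D : set E) (k : nat) (O K : set E) (f : E -> R) : Prop :=
  {within K, continuous f} /\
  if k is j.+1 then
    forall v, D v ->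
      (forall x, O x -> derivable f x v) /\
      exists g : E -> R,
        (forall x, O x -> g x = 'D_v f x) /\ Ck_along D j O K g
  else True.

Definition Ck := Ck_along [set: E].

Definition Cinfty (O K : set E) (f : E -> R) := forall k, Ck k O K f.

Definition test_function (O : set E) (f : E -> R) :=
  Cinfty setT setT f /\
  exists K : set E,
    [/\ compact K, K `<=` O & forall x, ~ K x -> f x = 0].

End Ck_spaces.

Section domain.
Context {R : realType} {d : nat}.
Implicit Types (Om W : set 'rV[R]_d) (f g : 'rV[R]_d -> R) (x nu : 'rV[R]_d).

Definition basis_vec (i : 'I_d) : 'rV[R]_d := delta_mx ord0 i.

Definition grad f x : 'rV[R]_d := \row_i 'D_(basis_vec i) f x.

Definition div (F : 'rV[R]_d -> 'rV[R]_d) x : R :=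
  \sum_i 'D_(basis_vec i) (fun y => F y ord0 i) x.

Definition dot (u v : 'rV[R]_d) : R := \sum_i u ord0 i * v ord0 i.

Definition bdry Om : set 'rV[R]_d := closure Om `\` interior Om.

Definition defining_function Om x W g :=
  [/\ open W, W x, Cinfty W W g, forall y, W y -> grad g y != 0
    & Om `&` W = [set y | g y < 0] `&` W].

Definition smooth_boundary Om :=
  forall x, bdry Om x -> exists W g, defining_function Om x W g.

Definition outer_normal Om x nu :=
  exists W g, defining_function Om x W g /\
    nu = (Num.sqrt (dot (grad g x) (grad g x)))^-1 *: grad g x.

Definition bounded_smooth_domain Om :=
  [/\ open Om, connected Om, bounded_set Om & smooth_boundary Om].

End domain.

Section one_dimensional.
Context {R : realType}.
Implicit Types (f U m : R -> R) (a b s : R).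

Definition W11 a b f :=
  lebesgue_measure.-integrable `]a, b[ (EFin \o f) /\
  exists g : R -> R,
    lebesgue_measure.-integrable `]a, b[ (EFin \o g) /\
    forall phi, test_function `]a, b[ phi ->
      \int[lebesgue_measure]_(x in `]a, b[) (f x * derive1 phi x) =
      - \int[lebesgue_measure]_(x in `]a, b[) (g x * phi x).

Definition oriented_integral f a b : R :=
  if a <= b then \int[lebesgue_measure]_(x in `]a, b[) f x
  else - \int[lebesgue_measure]_(x in `]b, a[) f x.

Definition flux_potential m U s0 s : R :=
  oriented_integral (fun t => m t * derive1n 2 U t) s0 s.

(* (f')^{-1} on (0, a), for f' strictly increasing there. *)
Definition deriv_inv a f (z : R) : R :=
  get [set s : R | 0 < s < a /\ derive1 f s = z].

(* T_{0,a} o (U')^{-1} *)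
Definition trunc_deriv_inv a U (z : R) : R :=
  let zlo := lim ((derive1 U s)%:E @[s --> 0^'+]) in
  let zhi := lim ((derive1 U s)%:E @[s --> a^'-]) in
  if (zhi <= z%:E)%E then a
  else if (z%:E <= zlo)%E then 0
  else deriv_inv a U z.

End one_dimensional.

Section problem.
Context {R : realType} {d : nat}.
Variables (Om : set 'rV[R]_d) (alpha : R).
Implicit Types (rho eta : 'rV[R]_d -> R) (U m Phi : R -> R) (V : 'rV[R]_d -> R).

Local Notation mu := (@lebesgue_rV R d).

Definition L1norm rho : \bar R := \int[mu]_(x in Om) `|rho x|%:E.

Definition L1dist rho eta : \bar R := L1norm (fun x => rho x - eta x).

(* Elements of L^1(Om) are represented by functions, identified when equal
   almost everywhere on Om.  A class with 0 <= rho <= alpha a.e. always has a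
   representative satisfying the bounds at every point of Om, and adm consists
   of such representatives; likewise for adm_pos. *)
Definition adm : set ('rV[R]_d -> R) :=
  [set rho | mu.-integrable Om (EFin \o rho) /\
             forall x, Om x -> 0 <= rho x <= alpha].

Definition adm_pos : set ('rV[R]_d -> R) :=
  [set rho | mu.-integrable Om (EFin \o rho) /\
     exists2 delta, 0 < delta &
       forall x, Om x -> delta <= rho x <= alpha - delta].

Definition adm_mass (M : R) : set ('rV[R]_d -> R) :=
  [set rho | adm rho /\ L1norm rho = M%:E].

Definition free_energy U V rho : \bar R :=
  (\int[mu]_(x in Om) (U (rho x))%:E + \int[mu]_(x in Om) (V x * rho x)%:E)%E.

Definition global_minimiser (F : ('rV[R]_d -> R) -> \bar R)
    (A : set ('rV[R]_d -> R)) rho :=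
  A rho /\ forall eta, A eta -> (F rho <= F eta)%E.

Definition L1_local_minimiser (F : ('rV[R]_d -> R) -> \bar R)
    (A : set ('rV[R]_d -> R)) rho :=
  A rho /\ exists2 delta : R, 0 < delta &
    forall eta, A eta -> (L1dist eta rho < delta%:E)%E -> (F rho <= F eta)%E.

Definition ae_unique (P : set ('rV[R]_d -> R)) rho :=
  P rho /\ forall eta, P eta -> ae_eq mu Om eta rho.

Definition L1_continuous (rho : R -> 'rV[R]_d -> R) :=
  forall t, 0 <= t ->
    L1dist (rho s) (rho t) @[s --> within [set s : R | 0 <= s] (nbhs t)] --> 0%E.

Definition semigroup_on_adm (S : R -> ('rV[R]_d -> R) -> 'rV[R]_d -> R) :=
  [/\ forall t rho, 0 <= t -> adm rho -> adm (S t rho),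
      forall rho, adm rho -> ae_eq mu Om (S 0 rho) rho
    & forall s t rho, 0 <= s -> 0 <= t -> adm rho ->
        ae_eq mu Om (S (s + t) rho) (S s (S t rho))].

Definition L1_contractive (S : R -> ('rV[R]_d -> R) -> 'rV[R]_d -> R) :=
  forall t rho eta, 0 <= t -> adm rho -> adm eta ->
    (L1dist (S t rho) (S t eta) <= L1dist rho eta)%E.

Definition flux m U V rho (x : 'rV[R]_d) : 'rV[R]_d :=
  m (rho x) *: grad (fun y => derive1 U (rho y) + V y) x.

(* Classical solutions with values in (0, alpha), where U' is defined, in
   C([0,oo) x closure Om) and in C^{1,2}((0,oo) x closure Om).  The boundary
   condition is taken on the trace of the flux from inside Om. *)
Definition classical_solution m U V rho0 (rho : R -> 'rV[R]_d -> R) :=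
  let rho_ (p : R * 'rV[R]_d) := rho p.1 p.2 in
  let O := [set p : R * 'rV[R]_d | 0 < p.1 /\ Om p.2] in
  let K := [set p : R * 'rV[R]_d | 0 < p.1 /\ closure Om p.2] in
  [/\ {within [set p : R * 'rV[R]_d | 0 <= p.1 /\ closure Om p.2], continuous rho_},
      Ck_along [set ((1, 0) : R * 'rV[R]_d)] 1 O K rho_ /\
      Ck_along [set v : R * 'rV[R]_d | v.1 = 0] 2 O K rho_,
      forall t x, 0 <= t -> closure Om x -> 0 < rho t x < alpha,
      (forall x, closure Om x -> rho 0 x = rho0 x) /\
      (forall t x, 0 < t -> Om x ->
        derive1 (rho ^~ x) t = div (flux m U V (rho t)) x)
    & forall t x nu, 0 < t -> bdry Om x -> outer_normal Om x nu ->
        dot (flux m U V (rho t) y) nu @[y --> within Om (nbhs x)] --> 0].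

(* The graph of the map from rho0 in A_+ and C^2(closure Om) to the classical
   solution is contained in the graph of S. *)
Definition extends_classical_solutions m U V
    (S : R -> ('rV[R]_d -> R) -> 'rV[R]_d -> R) :=
  forall rho0 (rho : R -> 'rV[R]_d -> R), adm_pos rho0 -> Ck 2 Om (closure Om) rho0 ->
    classical_solution m U V rho0 rho ->
    forall t, 0 <= t -> ae_eq mu Om (S t rho0) (rho t).

Definition weak_gradient (w : 'rV[R]_d -> R) (G : 'rV[R]_d -> 'rV[R]_d) :=
  forall i psi, test_function Om psi ->
    \int[mu]_(x in Om) (w x * 'D_(basis_vec i) psi x) =
    - \int[mu]_(x in Om) (G x ord0 i * psi x).

(* Weak solutions in C([0,oo); L^1(Om)).  The flux m(rho) grad (U'(rho) + V) is
   written grad Phi(rho) + m(rho) grad V, where Phi' = m U'', and Phi(rho) is in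
   L^2_loc([0,oo); H^1(Om)) with weak gradient G.  The test functions
   phi, smooth up to the boundary, encode the no-flux condition. *)
Definition weak_solution m Phi V rho0 (rho : R -> 'rV[R]_d -> R) :=
  [/\ forall t, 0 <= t -> adm (rho t),
      ae_eq mu Om (rho 0) rho0,
      L1_continuous rho
    & exists G : R -> 'rV[R]_d -> 'rV[R]_d,
      [/\ forall i, measurable_fun
            [set p : measurableTypeR R * 'rV[R]_d | 0 < p.1 /\ Om p.2]
            (fun p => G p.1 p.2 ord0 i),
          {ae lebesgue_measure, forall t : R, 0 < t ->
            weak_gradient (Phi \o rho t) (G t)},
          forall T : R, 0 < T ->
            (\int[lebesgue_measure]_(t in `]0%R, T[) \int[mu]_(x in Om)
              (Phi (rho t x) ^+ 2 + dot (G t x) (G t x))%:E < +oo)%E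
        & forall phi t, Cinfty Om (closure Om) phi -> 0 <= t ->
            \int[mu]_(x in Om) (rho t x * phi x)
              - \int[mu]_(x in Om) (rho0 x * phi x) =
            - \int[lebesgue_measure]_(s in `]0, t[) \int[mu]_(x in Om)
                dot (G s x + m (rho s x) *: grad V x) (grad phi x)]].

End problem.

Section assumptions.
Context {R : realType} {d : nat}.
Variables (Om : set 'rV[R]_d) (alpha s0 : R) (m U : R -> R) (V : 'rV[R]_d -> R).

Local Notation Phi := (flux_potential m U s0).

(* U is the representative of its W^{1,1} class that is continuous on
   [0, alpha]; this fixes U(0) and U(alpha). The last condition bounds the
   quotients at the points of (0, alpha) where they are defined. *)
Record standing_assumptions : Prop := {
  sa_domain : bounded_smooth_domain Om ;
  sa_alpha : 0 < alpha ;
  sa_m_C0 : {within `[0, alpha], continuous m} ;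
  sa_m_C1 : Ck 1 `]0, alpha[ `]0, alpha[ m ;
  sa_m_bdry : m 0 = 0 /\ m alpha = 0 ;
  sa_m_pos : forall s : R, 0 < s < alpha -> 0 < m s ;
  sa_V_C2 : Ck 2 Om (closure Om) V ;
  sa_V_ge0 : forall x, closure Om x -> 0 <= V x ;
  sa_U_W11 : W11 0 alpha U ;
  sa_U_C0 : {within `[0, alpha], continuous U} ;
  sa_U_C3 : Ck 3 `]0, alpha[ `]0, alpha[ U ;
  sa_U_convex : forall s : R, 0 < s < alpha -> 0 <= derive1n 2 U s ;
  sa_s0 : 0 < s0 < alpha /\ 0 < derive1n 2 U s0 ;
  sa_mU''_L1 : lebesgue_measure.-integrable `]0, alpha[
                 (fun s => (m s * derive1n 2 U s)%:E) ;
  sa_Phi : forall s : R, 0 < s < alpha -> Phi 0 < Phi s < Phi alpha ;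
  sa_sup : has_ubound
    [set `|(Phi alpha - Phi s) * Phi s / derive1 Phi s|
       + `|(Phi s - Phi 0) * Phi s / derive1 Phi s|
      | s in [set s : R | 0 < s < alpha /\ derive1 Phi s != 0]]
}.

(* f_eps --> f in C^k_loc((0, alpha)) as eps --> 0+ *)
Definition Ck_loc_cvg (k : nat) (f_ : R -> R -> R) (f : R -> R) :=
  forall (j : nat) (a b e : R), (j <= k)%N -> 0 < a -> b < alpha -> 0 < e ->
    \forall eps \near 0^'+, forall s : R, a <= s <= b ->
      `|derive1n j (f_ eps) s - derive1n j f s| <= e.

(* C^{3,1}((0, alpha)), the Lipschitz condition being local *)
Definition C31_loc (f : R -> R) :=
  Ck 3 `]0, alpha[ `]0, alpha[ f /\
  forall a b : R, 0 < a -> b < alpha -> exists L : R,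
    forall s t : R, a <= s <= b -> a <= t <= b ->
      `|derive1n 3 f s - derive1n 3 f t| <= L * `|s - t|.

Record regularisation (kappa : R -> R) (Phie me Ue : R -> R -> R) : Prop := {
  rg_kappa_gt0 : forall eps : R, 0 < eps <= 1 -> 0 < kappa eps ;
  rg_kappa_cvg : kappa eps @[eps --> 0^'+] --> 0 ;
  rg_Phie_C3 : forall eps : R, 0 < eps <= 1 ->
    Ck 3 `]0, alpha[ `[0, alpha] (Phie eps) ;
  rg_Phie_bounds : forall eps s : R, 0 < eps <= 1 -> 0 < s < alpha ->
    let g := Num.min (derive1 Phi s) (kappa eps)^-1 + eps in
    g <= derive1 (Phie eps) s <= (1 + eps) * g ;
  rg_Phie_s0 : forall eps : R, 0 < eps <= 1 -> Phie eps s0 = 0 ;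
  rg_Phie_cvg : Ck_loc_cvg 2 Phie Phi ;
  rg_me_C1 : forall eps : R, 0 < eps <= 1 ->
    Ck 1 `]0, alpha[ `[0, alpha] (me eps) ;
  rg_me_bdry : forall eps : R, 0 < eps <= 1 -> me eps 0 = 0 /\ me eps alpha = 0 ;
  rg_me_pos : forall eps s : R, 0 < eps <= 1 -> 0 < s < alpha -> 0 < me eps s ;
  rg_me_slope : forall eps : R, 0 < eps <= 1 ->
    (\forall s \near 0^'+, 1 < `|derive1 (me eps) s|) /\
    (\forall s \near alpha^'-, 1 < `|derive1 (me eps) s|) ;
  rg_Ue_C31 : forall eps : R, 0 < eps <= 1 -> C31_loc (Ue eps) ;
  rg_Ue'' : forall eps s : R, 0 < eps <= 1 -> 0 < s < alpha ->
    derive1n 2 (Ue eps) s = derive1 (Phie eps) s / me eps s ;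
  rg_Ue_mid : forall eps : R, 0 < eps <= 1 ->
    Ue eps (alpha / 2) = U (alpha / 2) /\
    derive1 (Ue eps) (alpha / 2) = derive1 U (alpha / 2) ;
  rg_me_cvg : forall s : R, 0 <= s <= alpha ->
    me eps s @[eps --> 0^'+] --> m s ;
  rg_Ue'_L1 :
    (ereal_sup [set \int[lebesgue_measure]_(s in `]0%R, alpha[)
                      `|derive1 (Ue eps) s|%:E | eps in `]0%R, 1%R[] < +oo)%E ;
  rg_me_joint :
    let mE (p : R * R) := if p.1 == 0 then m p.2 else me p.1 p.2 in
    {within [set p : R * R | 0 <= p.1 <= 1 /\ 0 <= p.2 <= alpha], continuous mE} /\
    Cinfty [set p : R * R | 0 < p.1 < 1 /\ 0 < p.2 < alpha]
      [set p : R * R | 0 < p.1 <= 1 /\ 0 <= p.2 <= alpha] mE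
}.

Definition regularised_semigroup (me Ue : R -> R)
    (S : R -> ('rV[R]_d -> R) -> 'rV[R]_d -> R) :=
  [/\ semigroup_on_adm Om alpha S,
      forall rho0, adm Om alpha rho0 -> L1_continuous Om (fun t => S t rho0),
      L1_contractive Om alpha S
    & extends_classical_solutions Om alpha me Ue V S].

(* S^{(eps_k)} rho0 --> S rho0 in C_loc([0,oo); L^1(Om)) for rho0 in A, where
   S is a semigroup of weak solutions. *)
Definition limit_semigroup (epsk : nat -> R)
    (Se : R -> R -> ('rV[R]_d -> R) -> 'rV[R]_d -> R)
    (S : R -> ('rV[R]_d -> R) -> 'rV[R]_d -> R) :=
  [/\ semigroup_on_adm Om alpha S,
      forall rho0, adm Om alpha rho0 ->
        weak_solution Om alpha m Phi V rho0 (fun t => S t rho0),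
      forall k, 0 < epsk k <= 1,
      epsk k @[k --> \oo] --> 0
    & forall rho0 (T e : R), adm Om alpha rho0 -> 0 < e ->
        \forall k \near \oo, forall t, 0 <= t <= T ->
          (L1dist Om (Se (epsk k) t rho0) (S t rho0) <= e%:E)%E].

End assumptions.

(* Main.v *)
Require Import Defs.
From HB Require Import structures.
From mathcomp Require Import all_boot all_order all_algebra.
From mathcomp Require Import all_classical all_reals all_analysis.
From mathcomp Require Import measurable_realfun.
From mathcomp Require Import lra.
Set Implicit Arguments.
Unset Strict Implicit.
Unset Printing Implicit Defensive.
Import Order.TTheory GRing.Theory Num.Theory.
Import numFieldNormedType.Exports.
Local Open Scope ring_scope.
Local Open Scope classical_set_scope.

(** The state at level C is rho_C(x) = T(C - V(x)), where T is the inverse of U'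
    truncated to [0, alpha].  Everything that the theorem says about T follows
    from one property, [crossing]: at every z, U' lies below z to the left of
    T(z) and above z to the right of T(z).  The inverse of Ue' has the same
    property, so that the degenerate and the regularised problems are treated
    by the same lemmas.

    - Mass.  T is nondecreasing and continuous, and tends to 0 and to alpha at
      the two infinities; by dominated convergence and the intermediate value
      theorem some level C0 has mass M.  If two levels had the same mass, then
      their states would agree on Om, since open sets have positive measure; T
      can take one value twice only if this value is 0 or alpha, and since Om
      is connected the state would be constantly 0 or constantly alpha, which
      the range of M excludes ([mass_exists], [mass_inj]).

    - Minimality (ii).  With zeta = C0 - V(x), the convex function
      s |-> U(s) - zeta s decreases strictly up to T(zeta) and increases
      strictly after it ([crossing_lt_min]).  Integrated over Om, the term
      C0 rho only sees the mass, hence the energy excess of a competitor is the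
      integral of a nonnegative density that vanishes only where the competitor
      equals rho_C0.  A local minimiser is moved towards rho_C0 along a
      segment; by convexity of the energy it is then a global one.

    - Convergence (iii).  Phie' and me converge locally uniformly on
      (0, alpha), so Ue'' = Phie'/me does, and Ue' converges pointwise because
      Ue'(alpha/2) = U'(alpha/2) ([Ue'_cvg]).  Crossing points depend
      continuously on the pair of function and level ([crossing_cvg]), which
      gives the convergence of the levels, and then of the states in L^1, by
      dominated convergence.

    - Regularised states.  me vanishes linearly at both ends and Phie' >= eps,
      so Ue' diverges logarithmically there and is onto; its inverse is C^2
      with values in (0, alpha).  Since Ue'(rho) + V = C is constant, the flux
      vanishes identically, and rho is a classical and a weak solution that
      does not depend on time ([stationary_classical], [stationary_weak]).  The
      weak gradient of Phie(rho) is obtained by integrating by parts on lines.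

    - Stationarity (i).  The regularised semigroups fix their stationary states
      at the level C0, are L^1 contractions, and converge to S; as these states
      converge to rho_C0, S fixes rho_C0 ([limit_semigroup_fixed]). *)

(** * Lebesgue measure and the topology of row vectors *)

Section measure_rV.
Context {R : realType}.

Lemma rV_ballP n (x y : 'rV[R]_n) e :
  0 < e -> ball x e y <-> forall i, ball (x ord0 i) e (y ord0 i).
Proof.
move=> e0; split=> [[_ H] i|H]; first exact: H.
by split=> // i j; rewrite [i]ord1; exact: H.
Qed.

Lemma measurable_rV_ball n (x : 'rV[R]_n) e : measurable (ball x e).
Proof.
have [e0|e0] := ltP 0 e; last first.
  rewrite (_ : ball x e = set0)//; apply/seteqP; split=> // y [+ _].
  by rewrite ltNge e0.
rewrite (_ : ball x e =
    \bigcap_(i in [set: 'I_n]) ((fun y => y ord0 i : measurableTypeR R) @^-1` ball (x ord0 i) e)).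
  apply: fin_bigcap_measurable => // i _.
  rewrite -[X in measurable X]setTI; apply: measurable_coord => //.
  rewrite ball_itv; exact: measurable_itv.
apply/seteqP; split=> y.
  by move=> /(rV_ballP _ _ e0) H i _; exact: H.
by move=> H; apply/(rV_ballP _ _ e0) => i; exact: H.
Qed.

(** The measurable sets are generated by the coordinates, so the topology enters
    through the countably many balls with rational centre and radius 1/(k+1). *)
Lemma open_measurable_rV n (O : set 'rV[R]_n) : open O -> measurable O.
Proof.
move=> oO.
pose q2r (q : 'rV[rat]_n) : 'rV[R]_n := map_mx ratr q.
pose F (p : 'rV[rat]_n * nat) :=
  if `[< ball (q2r p.1) (p.2.+1%:R^-1) `<=` O >]
  then ball (q2r p.1) (p.2.+1%:R^-1 : R) else set0.
rewrite (_ : O = \bigcup_p F p).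
  apply: countable_bigcupT_measurable; first exact: countableP.
  by move=> p; rewrite /F; case: ifP => // _; exact: measurable_rV_ball.
apply/seteqP; split=> [x Ox|x [p _]]; last first.
  by rewrite /F; case: ifPn => // /asboolP; exact.
have /nbhs_ballP[e/= e0 eO] : nbhs x O by exact: open_nbhs_nbhs.
have [k ke] : exists k, k.+1%:R^-1 < e / 2.
  have /cvgrPdist_lt/(_ (e / 2)) := @cvg_harmonic R.
  rewrite divr_gt0// => /(_ isT)[k _ /(_ k (leqnn _))].
  by rewrite /= sub0r normrN ger0_norm// => ?; exists k.
have k0 : 0 < k.+1%:R^-1 :> R by rewrite invr_gt0.
have H i : exists q : rat, ball (x ord0 i) (k.+1%:R^-1) (ratr q : R).
  have /rat_in_itvoo[q] : x ord0 i - k.+1%:R^-1 < x ord0 i + k.+1%:R^-1.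
    by rewrite ltrD2l gtrN.
  by rewrite in_itv/= -ltr_distlC => ?; exists q.
exists (\row_i projT1 (cid (H i)), k) => //.
have bx : ball (q2r (\row_i projT1 (cid (H i)))) k.+1%:R^-1 x.
  by apply/rV_ballP => // i; rewrite !mxE; apply: ball_sym; case: (cid (H i)).
rewrite /F/=; case: ifPn => // /asboolP; apply: contra_notP => _ y byx.
apply: eO.
apply: (@le_ball _ _ _ (k.+1%:R^-1 + k.+1%:R^-1)); first by rewrite [leRHS]splitr lerD ?ltW.
exact: (ball_triangle (ball_sym bx) byx).
Qed.

Lemma continuous_measurable_rV n (O : set 'rV[R]_n) (f : 'rV[R]_n -> R) :
  open O -> {within O, continuous f} -> measurable_fun O f.
Proof.
move=> oO; rewrite continuous_open_subspace// => cf.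
apply: (measurability _ (RGenOpens.measurableE R)) => _ [_ [a [b ->] <-]].
apply: open_measurable_rV; rewrite openE => x [Ox fx].
apply: filterI; first exact: open_nbhs_nbhs.
by apply: (cf x (mem_set Ox)); apply: open_nbhs_nbhs; split.
Qed.

(** For the maximum norm a ball is the product of an interval and a ball of one
    dimension less; this matches the recursive construction of the measure. *)
Lemma lebesgue_rV_ball n (x : 'rV[R]_n) e : 0 < e ->
  (0 < lebesgue_rV n (ball x e) < +oo)%E.
Proof.
move=> e0; elim: n x => [x|n IH x].
  rewrite /= diracE mem_set ?lte01 ?ltry//.
  by apply/rV_ballP => // -[].
rewrite /= /lebesgue_rV_step /pushforward/=.
rewrite (_ : _ @^-1` _ = ball (x ord0 ord0) e `*` ball (\row_j x ord0 (lift ord0 j)) e).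
  rewrite product_measure1E//; [|rewrite ball_itv; exact: measurable_itv|exact: measurable_rV_ball].
  rewrite [X in (X * _)%E](_ : _ = (e *+ 2)%:E); last first.
    by apply: lebesgue_measure_ball; rewrite ltW.
  have /andP[p1 p2] := IH (\row_j x ord0 (lift ord0 j)).
  rewrite mule_gt0 ?lte_fin ?mulrn_wgt0//=.
  by rewrite lte_mul_pinfty// lee_fin mulrn_wge0// ltW.
apply/seteqP; split=> -[a y]/=; rewrite /rV_cons.
  move/(rV_ballP _ _ e0) => H; split.
    by have := H ord0; rewrite mxE unlift_none.
  by apply/rV_ballP => // j; have := H (lift ord0 j); rewrite !mxE liftK.
move=> [H /(rV_ballP _ _ e0) H']; apply/rV_ballP => // i; rewrite mxE.
by case: unliftP => [j ->|->]//=; have := H' j; rewrite mxE.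
Qed.

Lemma lebesgue_rV_open_gt0 n (O : set 'rV[R]_n) : open O -> O !=set0 ->
  (0 < lebesgue_rV n O)%E.
Proof.
move=> oO [x Ox].
have /nbhs_ballP[e/= e0 eO] : nbhs x O by exact: open_nbhs_nbhs.
have /andP[+ _] := lebesgue_rV_ball x e0; move/lt_le_trans; apply.
apply: le_measure; rewrite ?inE//; first exact: measurable_rV_ball.
exact: open_measurable_rV.
Qed.

Lemma lebesgue_rV_bounded n (O : set 'rV[R]_n) :
  measurable O -> bounded_set O -> (lebesgue_rV n O < +oo)%E.
Proof.
move=> mO [B [_ HB]].
pose r := `|B| + 2.
have r0 : 0 < r by rewrite /r; have := normr_ge0 B; lra.
have /andP[_] := lebesgue_rV_ball (0 : 'rV[R]_n) r0; apply: le_lt_trans.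
apply: le_measure; rewrite ?inE//; first exact: measurable_rV_ball.
move=> x Ox; rewrite -ball_normE /ball_/= sub0r normrN.
apply: (@le_lt_trans _ _ (`|B| + 1)); last by rewrite /r; lra.
by apply: HB => //; have := ler_norm B; lra.
Qed.

End measure_rV.
(** * Integrability and integrals over lines *)

Section integrability.
Context {R : realType}.

Lemma bounded_integrable d (T : measurableType d)
    (mu : {measure set T -> \bar R}) (D : set T) (f : T -> R) (B : R) :
  measurable D -> (mu D < +oo)%E -> measurable_fun D f ->
  (forall x, D x -> `|f x| <= B) -> mu.-integrable D (EFin \o f).
Proof.
move=> mD muD mf fB; apply: measurable_bounded_integrable => //.
exists B; split; first by rewrite num_real.
by move=> C BC x Dx /=; rewrite (le_trans (fB _ Dx))// ltW.
Qed.

Lemma bounded_support_integrable d (T : measurableType d)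
    (mu : {measure set T -> \bar R}) (D : set T) (f : T -> R) (B : R) :
  measurable D -> (mu D < +oo)%E -> measurable_fun setT f ->
  (forall x, `|f x| <= B) -> (forall x, ~ D x -> f x = 0) ->
  mu.-integrable setT (EFin \o f).
Proof.
move=> mD muD mf fB f0.
have -> : EFin \o f = (EFin \o f) \_ D.
  apply/funext => x; rewrite /patch; case: ifPn => //=.
  by rewrite notin_setE => /f0 ->.
apply/(integrable_mkcond _ mD)/(bounded_integrable (B := B)) => //.
exact: measurable_funTS.
Qed.

Lemma integrable_realD d (T : measurableType d) (mu : {measure set T -> \bar R})
    (D : set T) (f g : T -> R) : measurable D ->
  mu.-integrable D (EFin \o f) -> mu.-integrable D (EFin \o g) ->
  mu.-integrable D (EFin \o (fun x => f x + g x)).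
Proof.
move=> mD fi gi; have := integrableD mD fi gi.
by congr integrable; apply/funext => x /=; rewrite EFinD.
Qed.

Lemma integrable_realB d (T : measurableType d) (mu : {measure set T -> \bar R})
    (D : set T) (f g : T -> R) : measurable D ->
  mu.-integrable D (EFin \o f) -> mu.-integrable D (EFin \o g) ->
  mu.-integrable D (EFin \o (fun x => f x - g x)).
Proof.
move=> mD fi gi; have := integrableB mD fi gi.
by congr integrable; apply/funext => x /=; rewrite EFinB.
Qed.

End integrability.

(** A directional derivative is a derivative along a line; this reduces the
    calculus of directional derivatives to that of one real variable. *)
Section lines.
Context {R : realType} {V : normedModType R}.

Let growth_line (f : V -> R) x v t :
  (fun h => h^-1 *: (((fun s => f (x + s *: v)) \o shift t) (h *: (1 : R))
                     - f (x + t *: v))) =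
  (fun h => h^-1 *: ((f \o shift (x + t *: v)) (h *: v) - f (x + t *: v))).
Proof.
apply/funext => h /=; congr (_ *: (f _ - _)).
by rewrite [h%:A]mulr1 scalerDl addrCA.
Qed.

Lemma is_derive_line (f : V -> R) x v (t df : R) :
  is_derive (x + t *: v) v f df <-> is_derive t 1 (fun s => f (x + s *: v)) df.
Proof.
split=> -[d1 d2]; split.
- by move: d1; rewrite /derivable growth_line.
- by move: d2; rewrite /derive growth_line.
- by move: d1; rewrite /derivable growth_line.
- by move: d2; rewrite /derive growth_line.
Qed.

End lines.

Section line_integrals.
Context {R : realType}.

Lemma rV_cons_basis0 n (t s : R) (y : 'rV[R]_n) :
  rV_cons (t, y) + s *: basis_vec ord0 = rV_cons (t + s, y).
Proof.
apply/rowP => i; rewrite !mxE eqxx/=.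
by case: unliftP => [j ->|->]/=; rewrite ?mulr1 ?mulr0 ?addr0.
Qed.

Lemma rV_cons_basis n (t s : R) (y : 'rV[R]_n) j :
  rV_cons (t, y) + s *: basis_vec (lift ord0 j) =
  rV_cons (t, y + s *: basis_vec j).
Proof.
apply/rowP => i; rewrite !mxE eqxx/=.
case: unliftP => [k ->|->]/=; last by rewrite mulr0 addr0.
by rewrite !mxE eqxx/= (inj_eq lift_inj).
Qed.

Lemma rV_cons_ball n (t : R) (y : 'rV[R]_n) A : 0 < A ->
  ball 0 A (rV_cons (t, y)) <-> ball 0 A t /\ ball 0 A y.
Proof.
move=> A0; split=> [/(rV_ballP _ _ A0) H|[H1 /(rV_ballP _ _ A0) H2]].
  split; first by have := H ord0; rewrite !mxE unlift_none.
  by apply/rV_ballP => // j; have := H (lift ord0 j); rewrite !mxE liftK.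
apply/rV_ballP => // i; rewrite !mxE.
by case: unliftP => [j _|_]//=; have := H2 j; rewrite mxE.
Qed.

(** Fubini in the direction i, by recursion on the dimension: the first
    coordinate is integrated first if i is its index, and last otherwise.
    Boundedness and bounded support, unlike integrability, pass to every slice. *)
Lemma integral_lines0 n (F : 'rV[R]_n -> R) (i : 'I_n) (A B : R) :
  0 < A -> measurable_fun setT F ->
  (forall x, `|F x| <= B) -> (forall x, ~ ball 0 A x -> F x = 0) ->
  (forall x, (\int[lebesgue_measure]_t (F (x + t *: basis_vec i))%:E = 0)%E) ->
  (\int[lebesgue_rV n]_x (F x)%:E = 0)%E.
Proof.
move=> A0; elim: n F i => [F []//|n IH F i mF FB F0 Fl].
have mG : measurable_fun setT (F \o @rV_cons R n).
  by apply: measurableT_comp => //; exact: measurable_rV_cons.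
have mb : measurable (ball (0 : R) A : set (measurableTypeR R)).
  by rewrite ball_itv; exact: measurable_itv.
pose BA := (ball (0 : R) A : set (measurableTypeR R)) `*` ball (0 : 'rV[R]_n) A.
have BAoo : ((lebesgue_measure \x lebesgue_rV n) BA < +oo)%E.
  rewrite /BA product_measure1E//; last exact: measurable_rV_ball.
  rewrite [X in (X * _)%E](_ : _ = (A *+ 2)%:E); last first.
    by apply: lebesgue_measure_ball; rewrite ltW.
  have /andP[p1 p2] := lebesgue_rV_ball (0 : 'rV[R]_n) A0.
  by rewrite lte_mul_pinfty// lee_fin mulrn_wge0// ltW.
have iG : (lebesgue_measure \x lebesgue_rV n)%E.-integrable setT
    (EFin \o (F \o @rV_cons R n)).
  apply: (bounded_support_integrable
    (D := BA) (B := B)) => //.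
  - by apply: measurableX => //; exact: measurable_rV_ball.
  - by move=> x; exact: FB.
  - by move=> [t y] /= H; apply: F0 => /(rV_cons_ball _ _ A0).
rewrite /= /lebesgue_rV_step integral_pushforward//=; last 2 first.
  exact: measurable_rV_cons.
  by apply/measurable_EFinP.
have [j|] := unliftP ord0 i; move=> ij; subst i.
- rewrite -integral12_prod_meas1//.
  apply: integral0_eq => t _; rewrite /fubini_F/=.
  apply: (IH (fun y => F (rV_cons (t, y))) j) => //.
  + by apply: measurableT_comp mG _; exact: measurable_pair1.
  + by move=> y Hy; apply: F0 => /(rV_cons_ball _ _ A0)[].
  + move=> y; rewrite -[RHS](Fl (rV_cons (t, y))).
    by apply: eq_integral => s _; rewrite rV_cons_basis.
- rewrite -integral21_prod_meas1//.
  apply: integral0_eq => y _; rewrite /fubini_G/=.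
  rewrite -[RHS](Fl (rV_cons (0, y))).
  by apply: eq_integral => s _; rewrite rV_cons_basis0 add0r.
Qed.

End line_integrals.
(** * Functions of class C^k *)

Section Ck_theory.
Context {R : realType} {E : normedModType R}.
Implicit Types (D : set E) (O K : set E) (f g : E -> R).

Lemma is_derive_comp (h : R -> R) f x v (dh df : R) :
  is_derive (f x) 1 h dh -> is_derive x v f df ->
  is_derive x v (h \o f) (dh * df).
Proof.
move=> hh; rewrite -{1 2}[x]addr0 -(scale0r v) => /is_derive_line hf.
apply/is_derive_line.
rewrite (_ : (fun s => _) = h \o (fun s => f (x + s *: v)))//.
apply: (@is_derive1_comp _ h (fun s => f (x + s *: v)) 0 dh df) => //.
by rewrite scale0r addr0.
Qed.

Lemma Ck_along_continuous D k O K f :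
  Ck_along D k O K f -> {within K, continuous f}.
Proof. by case: k => [|k] []. Qed.

Lemma Ck_along_pred D k O K f : Ck_along D k.+1 O K f -> Ck_along D k O K f.
Proof.
elim: k f => [|k IH] f; first by move=> [].
move=> [cf H]; split=> // v Dv; have [df [g [gE gC]]] := H v Dv.
by split=> //; exists g; split=> //; exact: IH.
Qed.

Lemma Ck_along_cst D k O K (c : R) : Ck_along D k O K (cst c).
Proof.
elim: k c => [|k IH] c; split=> //; try by move=> x; exact: cvg_cst.
move=> v _; split=> [x _|]; first exact: derivable_cst.
by exists (cst 0); split=> [x _|]; [rewrite derive_cst | exact: IH].
Qed.

Lemma Ck_along_add D k O K f g :
  Ck_along D k O K f -> Ck_along D k O K g -> Ck_along D k O K (f + g).
Proof.
elim: k f g => [|k IH] f g [cf Hf] [cg Hg]; split=> //;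
  try by move=> x; exact: cvgD (cf x) (cg x).
move=> v Dv; have [df [f' [f'E f'C]]] := Hf v Dv.
have [dg [g' [g'E g'C]]] := Hg v Dv.
split=> [x Ox|]; first by apply: derivableD; [exact: df|exact: dg].
exists (f' + g'); split; last exact: IH.
by move=> x Ox; rewrite deriveD ?fctE ?f'E ?g'E//; [exact: df|exact: dg].
Qed.

Lemma Ck_along_mul D k O K f g :
  Ck_along D k O K f -> Ck_along D k O K g -> Ck_along D k O K (f * g).
Proof.
elim: k f g => [|k IH] f g; move=> /[dup] Cf [cf Hf] /[dup] Cg [cg Hg]; split=> //;
  try by move=> x; exact: cvgM (cf x) (cg x).
move=> v Dv; have [df [f' [f'E f'C]]] := Hf v Dv.
have [dg [g' [g'E g'C]]] := Hg v Dv.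
split=> [x Ox|]; first by apply: derivableM; [exact: df|exact: dg].
exists (f * g' + g * f'); split; last first.
  by apply: Ck_along_add; apply: IH => //; exact: Ck_along_pred.
by move=> x Ox; rewrite deriveM ?fctE ?f'E ?g'E//; [exact: df|exact: dg].
Qed.

Lemma within_continuous_comp K f (h : R -> R) :
  {within K, continuous f} -> (forall x, K x -> {for f x, continuous h}) ->
  {within K, continuous (h \o f)}.
Proof.
move=> /subspace_continuousP cf ch; apply/subspace_continuousP => x Kx.
by apply: (cvg_comp _ _ (cf x Kx)); exact: ch.
Qed.

(** H lists h = H 0 and its successive derivatives, which makes the chain rule an
    induction on k: the derivative of H 0 o f is a product of H 1 o f and a
    derivative of f. *)
Lemma Ck_along_comp D k O K (H : nat -> R -> R) f :
  (forall i z, (i < k)%N -> is_derive (z : R) (1 : R) (H i) (H i.+1 z)) ->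
  (forall i, (i <= k)%N -> continuous (H i)) ->
  Ck_along D k O K f -> Ck_along D k O K (H 0%N \o f).
Proof.
elim: k H f => [|k IH] H f dH cH; move=> /[dup] Cf [cf Hf]; split=> //;
  try by apply: within_continuous_comp cf _ => x _; exact: (cH 0%N).
move=> v Dv; have [df [f' [f'E f'C]]] := Hf v Dv.
have dc x : O x -> is_derive x v (H 0%N \o f) (H 1%N (f x) * 'D_v f x).
  move=> Ox; apply: is_derive_comp; first exact: dH.
  exact/derivableP/df.
split=> [x Ox|]; first by have [] := dc _ Ox.
exists ((H 1%N \o f) * f'); split.
  by move=> x Ox; have [_ ->] := dc _ Ox; rewrite fctE f'E.
apply: Ck_along_mul => //.
apply: (IH (fun i => H i.+1)).
- by move=> i z ik; exact: dH.
- by move=> i ik; exact: cH.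
- exact: Ck_along_pred.
Qed.

Lemma within_continuous_snd (I : set R) K f :
  {within K, continuous f} ->
  {within [set p : R * E | I p.1 /\ K p.2], continuous (fun p => f p.2)}.
Proof.
move=> /subspace_continuousP cf; apply/subspace_continuousP => -[t x] [/= It Kx].
move=> A fA; have {}fA : nbhs x [set y | K y -> A (f y)] := cf _ Kx _ fA.
have H : nbhs (t, x) [set p : R * E | K p.2 -> A (f p.2)].
  by exists (setT, [set y | K y -> A (f y)]); [split=> //; exact: filterT|move=> p []].
change (nbhs (t, x) [set p : R * E | I p.1 /\ K p.2 -> A (f p.2)]).
by apply: filterS H => p H [_ Kp]; exact: H.
Qed.

(** With [Ck_along_snd_fst]: a function that does not depend on time has the
    space-time regularity demanded of classical solutions. *)
Lemma Ck_along_snd k (I : set R) O K f : Ck k O K f ->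
  Ck_along [set v : R * E | v.1 = 0] k
    [set p | I p.1 /\ O p.2] [set p | I p.1 /\ K p.2] (fun p => f p.2).
Proof.
elim: k f => [|k IH] f [cf Hf]; split=> //; try exact: within_continuous_snd.
move=> [a v] /= ->; have [df [f' [f'E f'C]]] := Hf v Logic.I.
have dc p : O p.2 -> is_derive p ((0, v) : R * E) (fun p : R * E => f p.2) ('D_v f p.2).
  move=> Op; rewrite -{1}[p]addr0 -(scale0r (0 : R, v)); apply/is_derive_line.
  apply/(is_derive_line f p.2 v); rewrite scale0r addr0.
  exact/derivableP/df.
split=> [p [_ Op]|]; first by have [] := dc _ Op.
exists (fun p => f' p.2); split; last exact: IH.
by move=> p [_ Op]; have [_ ->] := dc _ Op; exact: f'E.
Qed.

Lemma Ck_along_snd_fst (I : set R) O K f : {within K, continuous f} ->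
  Ck_along [set ((1, 0) : R * E)] 1
    [set p | I p.1 /\ O p.2] [set p | I p.1 /\ K p.2] (fun p => f p.2).
Proof.
move=> cf; split; first exact: within_continuous_snd.
move=> _ ->.
have dc p : is_derive p ((1, 0) : R * E) (fun p : R * E => f p.2) 0.
  rewrite -{1}[p]addr0 -(scale0r (1 : R, 0 : E)); apply/is_derive_line.
  rewrite (_ : (fun s => _) = cst (f p.2)); first exact: is_derive_cst.
  by apply/funext => s /=; rewrite scaler0 addr0.
split=> [p _|]; first by have [] := dc p.
exists (cst 0); split; last by split=> // x; exact: cvg_cst.
by move=> p _; have [_ ->] := dc p.
Qed.

End Ck_theory.

(** * Integration by parts against test functions *)

Section integration_by_parts.
Context {R : realType}.

Lemma near_eq_continuous (T U : topologicalType) (f g : T -> U) x :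
  {near x, g =1 f} -> {for x, continuous g} -> {for x, continuous f}.
Proof.
move=> gf cg; rewrite /prop_for/continuous_at -(nbhs_singleton gf).
by apply: cvg_trans cg; exact: near_eq_cvg.
Qed.

Lemma compact_continuous_bounded (T : topologicalType) (K : set T) (f : T -> R) :
  compact K -> {within K, continuous f} ->
  exists2 B : R, 0 <= B & forall x, K x -> `|f x| <= B.
Proof.
move=> cK cf; have /compact_bounded[M [_ HM]] := continuous_compact cf cK.
exists (`|M| + 1) => [|x Kx]; first by rewrite addr_ge0.
by apply: HM; [rewrite ltr_pwDr// ler_norm | exists x].
Qed.

Lemma test_function_derive n (Om : set 'rV[R]_n) (psi : 'rV[R]_n -> R) v :
  test_function Om psi ->
  [/\ continuous psi, continuous ('D_v psi) & forall x, derivable psi x v].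
Proof.
move=> [/(_ 1%N)[cpsi /(_ v Logic.I)[dpsi [g [gE [cg _]]]]] _].
split=> [||x]; last exact: dpsi.
  exact/continuous_subspace_setT.
rewrite (_ : 'D_v psi = g); first exact/continuous_subspace_setT.
by apply/funext => x; rewrite gE.
Qed.

Lemma integral_line_derive0 (phi dphi : R -> R) (T : R) :
  (forall t, is_derive t (1 : R) phi (dphi t)) -> continuous dphi ->
  (forall t, T <= `|t| -> phi t = 0 /\ dphi t = 0) ->
  (\int[lebesgue_measure]_t (dphi t)%:E = 0)%E.
Proof.
move=> dp cd H0; pose S := `|T| + 1.
have TS : T <= S by rewrite /S; have := ler_norm T; lra.
have S0 : 0 < S by rewrite ltr_wpDl.
have NSS : - S < S by lra.
have -> : (fun t => (dphi t)%:E) = (fun t => (dphi t)%:E) \_ `[- S, S].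
  apply/funext => t; rewrite /patch; case: ifPn => //.
  rewrite notin_setE/= in_itv/= => /negP; rewrite -ler_norml -ltNge => St.
  by rewrite (H0 t _).2// (le_trans TS)// ltW.
rewrite -integral_mkcond (continuous_FTC2 (F := phi)) //.
- rewrite (H0 S _).1 ?(H0 (- S) _).1 ?subee// ?normrN.
    by rewrite (le_trans TS)// ler_norm.
  by rewrite (le_trans TS)// ler_norm.
- exact: continuous_subspaceT.
- have cp : continuous phi.
    by move=> t; apply: differentiable_continuous; apply/derivable1_diffP; have [] := dp t.
  split.
  + by move=> t _; have [] := dp t.
  + exact/cvg_at_right_filter/cp.
  + exact/cvg_at_left_filter/cp.
- by move=> t _; rewrite derive1E; have [_ ->] := dp t.
Qed.

(** Extended by zero outside Om, w psi is differentiable along every line with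
    direction i, with compact support and continuous derivative.  Thus the
    derivative of w psi integrates to zero on each of these lines, and then over
    the whole space. *)
Lemma integration_by_parts_test n (Om : set 'rV[R]_n) (w g psi : 'rV[R]_n -> R)
    (i : 'I_n) :
  open Om -> (lebesgue_rV n Om < +oo)%E ->
  {within Om, continuous w} -> {within Om, continuous g} ->
  (forall x, Om x -> is_derive x (basis_vec i) w (g x)) ->
  test_function Om psi ->
  \int[lebesgue_rV n]_(x in Om) (w x * 'D_(basis_vec i) psi x) =
  - \int[lebesgue_rV n]_(x in Om) (g x * psi x).
Proof.
move=> oO Ooo cw cg dw tpsi.
have [cpsi cdpsi dpsi] := test_function_derive (basis_vec i) tpsi.
have [_ [K [cK KO psi0]]] := tpsi.
have oK : open (~` K) by apply: closed_openC; apply: compact_closed cK; exact: norm_hausdorff.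
have dpsi0 x : ~ K x -> 'D_(basis_vec i) psi x = 0.
  move=> Kx; rewrite (@near_eq_derive _ _ _ psi (cst 0)) ?derive_cst//.
  by near=> y; apply: psi0; near: y; exact: open_nbhs_nbhs.
move: (cw) (cg); rewrite !continuous_open_subspace// => cw' cg'.
have mO := open_measurable_rV oO.
have Cwd : {within Om, continuous (fun x => w x * 'D_(basis_vec i) psi x)}.
  rewrite continuous_open_subspace// => x Ox.
  exact: (cvgM (cw' x Ox) (cdpsi x)).
have Cgp : {within Om, continuous (fun x => g x * psi x)}.
  rewrite continuous_open_subspace// => x Ox.
  exact: (cvgM (cg' x Ox) (cpsi x)).
have [B1 B10 HB1] := compact_continuous_bounded cK (continuous_subspaceW KO Cwd).
have [B2 B20 HB2] := compact_continuous_bounded cK (continuous_subspaceW KO Cgp).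
have I1 : (lebesgue_rV n).-integrable Om (EFin \o (fun x => w x * 'D_(basis_vec i) psi x)).
  apply: (bounded_integrable (B := B1)) => //.
    exact: continuous_measurable_rV.
  move=> x Ox; have [/HB1//|/dpsi0 ->] := pselect (K x).
  by rewrite mulr0 normr0.
have I2 : (lebesgue_rV n).-integrable Om (EFin \o (fun x => g x * psi x)).
  apply: (bounded_integrable (B := B2)) => //.
    exact: continuous_measurable_rV.
  move=> x Ox; have [/HB2//|/psi0 ->] := pselect (K x).
  by rewrite mulr0 normr0.
apply/eqP; rewrite -subr_eq0 opprK -RintegralD//; apply/eqP.
rewrite Rintegral_mkcond /Rintegral.
pose F : 'rV[R]_n -> R := (fun x => w x * 'D_(basis_vec i) psi x + g x * psi x) \_ Om.
pose h : 'rV[R]_n -> R := (fun x => w x * psi x) \_ Om.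
have FO x : Om x -> F x = w x * 'D_(basis_vec i) psi x + g x * psi x.
  by move=> Ox; rewrite /F patchE mem_set.
have F0 x : ~ K x -> F x = 0.
  move=> Kx; rewrite /F patchE; case: ifP => // _.
  by rewrite psi0// dpsi0// !mulr0 addr0.
have h0 x : ~ K x -> h x = 0.
  by move=> Kx; rewrite /h patchE; case: ifP => // _; rewrite psi0// mulr0.
have cF : continuous F.
  move=> x; have [Kx|Kx] := pselect (K x); last first.
    apply: (near_eq_continuous (g := cst (0 : R))); last exact: cst_continuous.
    near=> y; rewrite F0//.
    by near: y; exact: open_nbhs_nbhs.
  have Ox := KO _ Kx.
  apply: (near_eq_continuous
    (g := fun x => w x * 'D_(basis_vec i) psi x + g x * psi x)); last first.
    exact: (cvgD (cvgM (cw' x (mem_set Ox)) (cdpsi x))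
      (cvgM (cg' x (mem_set Ox)) (cpsi x))).
  near=> y; rewrite FO//.
  by near: y; exact: open_nbhs_nbhs.
have dh x : is_derive x (basis_vec i) h (F x).
  have [Kx|Kx] := pselect (K x); last first.
    rewrite F0//; apply: (@near_eq_is_derive _ _ _ (cst 0)).
    near=> y; rewrite h0//.
    by near: y; exact: open_nbhs_nbhs.
  have Ox := KO _ Kx.
  apply: (@near_eq_is_derive _ _ _ (w * psi)).
    near=> y; rewrite /h patchE mem_set//.
    by near: y; exact: open_nbhs_nbhs.
  have dwx := dw _ Ox; have dpx : is_derive x (basis_vec i) psi _ := derivableP (dpsi x).
  by apply: is_derive_eq; rewrite FO// /GRing.scale/= [g x * _]mulrC.
have [A1 [_ HA]] := compact_bounded cK.
pose A : R := `|A1| + 1.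
have A0 : 0 < A by rewrite /A ltr_wpDl.
have KA x : ~ ball 0 (A + 1) x -> ~ K x.
  apply: contra_not => Kx; rewrite -ball_normE/= sub0r normrN.
  rewrite (@le_lt_trans _ _ A)// ?ltrDl//; apply: HA => //.
  by rewrite /A; have := ler_norm A1; lra.
rewrite (@integral_lines0 _ _ F i (A + 1) (B1 + B2))//; first by lra.
- apply: continuous_measurable_rV; first exact: openT.
  exact: continuous_subspaceT.
- move=> x; have [Kx|/F0 ->] := pselect (K x); last by rewrite normr0 addr_ge0.
  rewrite FO ?(le_trans (ler_normD _ _))//; last exact: KO.
  by rewrite lerD// ?HB1 ?HB2.
- by move=> x /KA /F0.
- move=> x; apply: (@integral_line_derive0 (fun t : R => h (x + t *: basis_vec i))
    (fun t : R => F (x + t *: basis_vec i))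
    (A + 1 + `|x ord0 i|)).
  + by move=> t; apply/(is_derive_line h x (basis_vec i)).
  + move=> t; apply: (@continuous_comp _ _ _ (fun t : R => x + t *: basis_vec i) F);
      last exact: cF.
    by apply: cvgD; [exact: cvg_cst|apply: cvgZr_tmp; exact: cvg_id].
  + move=> t tA; have nK : ~ K (x + t *: basis_vec i).
      apply: KA => /rV_ballP => /(_ _)/(_ i); rewrite !mxE !eqxx mulr1.
      rewrite -ball_normE/= sub0r normrN => H.
      have : `|t| <= `|x ord0 i + t| + `|x ord0 i|.
        by rewrite -[t in leLHS](addKr (x ord0 i)) addrC (le_trans (ler_normB _ _)).
      by have := H ltac:(lra); lra.
    by rewrite h0// F0.
Unshelve. all: by end_near. Qed.

End integration_by_parts.
(** * Truncated inverses of monotone functions *)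

Section crossing.
Context {R : realType}.
Implicit Types (a c z : R) (f T : R -> R).

(** T is the generalised inverse of the nondecreasing function f on (0, a),
    truncated to [0, a].  The values of f at the end points do not occur, so f
    may be unbounded there. *)
Definition crossing a f T := forall z, 0 <= T z <= a /\
  forall c, 0 < c < a -> (c < T z -> f c < z) /\ (T z < c -> z < f c).

Lemma crossing_le a f T z1 z2 : crossing a f T -> z1 <= z2 -> T z1 <= T z2.
Proof.
move=> cT z12; rewrite leNgt; apply/negP => T21.
have [/andP[T10 T1a] H1] := cT z1; have [/andP[T20 T2a] H2] := cT z2.
have c0a : 0 < (T z1 + T z2) / 2 < a by lra.
have [/(_ ltac:(lra)) F1 _] := H1 _ c0a.
have [_ /(_ ltac:(lra)) F2] := H2 _ c0a.
by move: (lt_trans F2 F1); rewrite ltNge z12.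
Qed.

(** If c < T z then f c < z, an inequality that persists for f_ i and z_ i and
    confines T_ i (z_ i) to the right of c; likewise on the other side. *)
Lemma crossing_cvg {I : Type} (F : set_system I) {FF : ProperFilter F} a
    (f_ : I -> R -> R) (T_ : I -> R -> R) (z_ : I -> R) f T z :
  (\forall i \near F, crossing a (f_ i) (T_ i)) -> crossing a f T ->
  (forall c, 0 < c < a -> f_ i c @[i --> F] --> f c) ->
  z_ i @[i --> F] --> z ->
  T_ i (z_ i) @[i --> F] --> T z.
Proof.
move=> cT_ cT ff zz; have [/andP[T0 Ta] HT] := cT z.
apply/cvgrPdist_lt => e e0.
have low : \forall i \near F, T z - e < T_ i (z_ i).
  have [c0|c0] := leP (T z - e / 2) 0.
    near=> i; have ci : crossing a (f_ i) (T_ i) by near: i.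
    by have [/andP[Ti0 _] _] := ci (z_ i); lra.
  have ca : 0 < T z - e / 2 < a by lra.
  have [/(_ ltac:(lra)) fz _] := HT _ ca.
  have near_lt : \forall i \near F, f_ i (T z - e / 2) - z_ i < 0.
    by apply: cvgr_lt (cvgB (ff _ ca) zz) _ _; rewrite subr_lt0.
  near=> i.
  have ci : crossing a (f_ i) (T_ i) by near: i.
  have fi : f_ i (T z - e / 2) - z_ i < 0 by near: i.
  have [_ /(_ _ ca)[_ H]] := ci (z_ i).
  have [/H|] := ltP (T_ i (z_ i)) (T z - e / 2); lra.
have upp : \forall i \near F, T_ i (z_ i) < T z + e.
  have [c0|c0] := leP a (T z + e / 2).
    near=> i; have ci : crossing a (f_ i) (T_ i) by near: i.
    by have [/andP[_ Tia] _] := ci (z_ i); lra.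
  have ca : 0 < T z + e / 2 < a by lra.
  have [_ /(_ ltac:(lra)) fz] := HT _ ca.
  have near_gt : \forall i \near F, 0 < f_ i (T z + e / 2) - z_ i.
    by apply: cvgr_gt (cvgB (ff _ ca) zz) _ _; rewrite subr_gt0.
  near=> i.
  have ci : crossing a (f_ i) (T_ i) by near: i.
  have fi : 0 < f_ i (T z + e / 2) - z_ i by near: i.
  have [_ /(_ _ ca)[H _]] := ci (z_ i).
  have [/H|] := ltP (T z + e / 2) (T_ i (z_ i)); lra.
near=> i; rewrite ltr_distlC; apply/andP; split; by near: i.
Unshelve. all: by end_near. Qed.

Lemma crossing_continuous a f T : crossing a f T -> continuous T.
Proof.
move=> cT z; apply: (@crossing_cvg _ (nbhs z) _ a (fun=> f) (fun=> T) id f T z) => //.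
- by near=> i.
- by move=> c _; exact: cvg_cst.
Unshelve. all: by end_near. Qed.

Lemma crossing_cvg_pinfty {I : Type} (F : set_system I) {FF : Filter F} a f T
    (z_ : I -> R) : 0 < a -> crossing a f T ->
  z_ i @[i --> F] --> +oo -> T (z_ i) @[i --> F] --> a.
Proof.
move=> a0 cT /cvgryPgt zz; apply/cvgrPdist_lt => e e0.
have [ca|ca] := ltP (a - e / 2) 0.
  near=> i; have [/andP[H1 H2] _] := cT (z_ i).
  by rewrite ger0_norm; lra.
pose c := (a + (a - e / 2)) / 2.
have c0a : 0 < c < a by rewrite /c; lra.
near=> i; have [/andP[H1 H2] /(_ _ c0a)[_ H3]] := cT (z_ i).
have zi : f c < z_ i by near: i; exact: zz.
have cTi : c <= T (z_ i) by rewrite leNgt; apply/negP => /H3; lra.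
by rewrite ger0_norm; rewrite /c in cTi; lra.
Unshelve. all: by end_near. Qed.

Lemma crossing_cvg_ninfty {I : Type} (F : set_system I) {FF : Filter F} a f T
    (z_ : I -> R) : 0 < a -> crossing a f T ->
  z_ i @[i --> F] --> -oo -> T (z_ i) @[i --> F] --> 0.
Proof.
move=> a0 cT /cvgrNyPlt zz; apply/cvgrPdist_lt => e e0.
have [ca|ca] := ltP a (e / 2).
  near=> i; have [/andP[H1 H2] _] := cT (z_ i).
  by rewrite sub0r normrN ger0_norm; lra.
pose c := e / 4.
have c0a : 0 < c < a by rewrite /c; lra.
near=> i; have [/andP[H1 H2] /(_ _ c0a)[H3 _]] := cT (z_ i).
have zi : z_ i < f c by near: i; exact: zz.
have cTi : T (z_ i) <= c by rewrite leNgt; apply/negP => /H3; lra.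
by rewrite sub0r normrN ger0_norm; rewrite /c in cTi; lra.
Unshelve. all: by end_near. Qed.

(** At an interior point t = T z1 = T z2, continuity of f gives z2 <= f t <= z1. *)
Lemma crossing_flat a f T z1 z2 : crossing a f T ->
  (forall c, 0 < c < a -> {for c, continuous f}) ->
  z1 < z2 -> T z1 = T z2 -> T z1 = 0 \/ T z1 = a.
Proof.
move=> cT cf z12 T12; have [/andP[T10 T1a] H1] := cT z1.
have [_ H2] := cT z2.
move: T10; rewrite le_eqVlt => /predU1P[<-|T10]; first by left.
move: T1a; rewrite le_eqVlt => /predU1P[->|T1a]; first by right.
exfalso; set t := T z1 in T12 T10 T1a H1 H2.
have ta : 0 < t < a by rewrite T10.
have f2 : z2 <= f t.
  apply: (cvgr_to_ge (cvg_at_right_filter (cf t ta))); near=> c; apply/ltW.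
  have tc : t < c by near: c; exact: nbhs_right_gt.
  have ca : c < a by near: c; exact: nbhs_right_lt.
  by apply: (H2 c _).2; rewrite -?T12// ca (lt_trans T10).
have f1 : f t <= z1.
  apply: (cvgr_to_le (cvg_at_left_filter (cf t ta))); near=> c; apply/ltW.
  have tc : c < t by near: c; exact: nbhs_left_lt.
  have ca : 0 < c by near: c; exact: nbhs_left_gt.
  by apply: (H1 c _).1; rewrite // ca (lt_trans tc).
by move: (le_trans f2 f1); rewrite leNgt z12.
Unshelve. all: by end_near. Qed.

(** Stated on the closed interval because densities may take the values 0 and a,
    where U' may blow up. *)
Lemma MVT_cc a (U : R -> R) (x y : R) :
  {within `[0, a], continuous U} -> (forall c, 0 < c < a -> derivable U c 1) ->
  0 <= x -> y <= a -> x < y ->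
  exists2 c : R, x < c < y & U y - U x = derive1 U c * (y - x).
Proof.
move=> cU dU x0 ya xy; have [||c cxy ->] := @MVT _ U (derive1 U) x y xy.
- move=> c; rewrite in_itv/= => /andP[xc cy]; rewrite derive1E.
  by apply/derivableP/dU; rewrite (le_lt_trans x0)// (lt_le_trans cy).
- apply: continuous_subspaceW cU => c /=; rewrite !in_itv/= => /andP[xc cy].
  by rewrite (le_trans x0)// (le_trans cy).
- by exists c => //; move: cxy; rewrite in_itv.
Qed.

Lemma convex_derive_le a (U : R -> R) (t x y : R) :
  {within `[0, a], continuous U} -> (forall c, 0 < c < a -> derivable U c 1) ->
  (forall c d : R, 0 < c < a -> 0 < d < a -> c < d -> derive1 U c <= derive1 U d) ->
  0 < t < 1 -> 0 <= x <= a -> 0 <= y <= a ->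
  U ((1 - t) * x + t * y) <= (1 - t) * U x + t * U y.
Proof.
move=> cU dU mU.
have le_xy (r u v : R) : 0 < r < 1 -> 0 <= u -> v <= a -> u < v ->
    U ((1 - r) * u + r * v) <= (1 - r) * U u + r * U v.
  move=> r01 u0 va uv; set p := (1 - r) * u + r * v.
  have pu : p - u = r * (v - u) by rewrite /p; lra.
  have vp : v - p = (1 - r) * (v - u) by rewrite /p; lra.
  have up : u < p by rewrite -subr_gt0 pu mulr_gt0//; lra.
  have pv : p < v by rewrite -subr_gt0 vp mulr_gt0//; lra.
  have [|c ucp E1] := MVT_cc cU dU u0 _ up; first by lra.
  have [|d pdv E2] := MVT_cc cU dU _ va pv; first by lra.
  have cd : derive1 U c <= derive1 U d by apply: mU; lra.
  have : (1 - r) * (U p - U u) <= r * (U v - U p).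
    rewrite E1 E2 pu vp [leLHS](_ : _ = derive1 U c * (r * (1 - r) * (v - u))); last by lra.
    rewrite [leRHS](_ : _ = derive1 U d * (r * (1 - r) * (v - u))); last by lra.
    by rewrite ler_wpM2r// !mulr_ge0//; lra.
  lra.
move=> t01 /andP[x0 xa] /andP[y0 ya]; have [xy|yx|->] := ltgtP x y.
- exact: le_xy.
- have := le_xy (1 - t) y x ltac:(lra) y0 xa yx.
  by rewrite subKr addrC [leRHS]addrC.
- by rewrite -!mulrDl subrK !mul1r.
Qed.

(** The derivative of s |-> U s - z s changes sign at T z only. *)
Lemma crossing_lt_min a (U T : R -> R) z s : crossing a (derive1 U) T ->
  {within `[0, a], continuous U} ->
  (forall c, 0 < c < a -> derivable U c 1) ->
  0 <= s <= a -> s != T z -> U (T z) - z * T z < U s - z * s.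
Proof.
move=> cT cU dU /andP[s0 sa] sT; have [/andP[T0 Ta] H] := cT z.
move: sT; rewrite neq_lt => /orP[sT|Ts].
- have [c /andP[sc cT'] E] := MVT_cc cU dU s0 Ta sT.
  have [/(_ cT') fc _] := H c ltac:(lra).
  by have : derive1 U c * (T z - s) < z * (T z - s); [rewrite ltr_pM2r ?subr_gt0//; lra|lra].
- have [c /andP[sc cT'] E] := MVT_cc cU dU T0 sa Ts.
  have [_ /(_ sc) fc] := H c ltac:(lra).
  by have : z * (s - T z) < derive1 U c * (s - T z); [rewrite ltr_pM2r ?subr_gt0//; lra|lra].
Qed.

Lemma deriv_invP a (f : R -> R) z :
  (exists2 s : R, 0 < s < a & derive1 f s = z) ->
  0 < deriv_inv a f z < a /\ derive1 f (deriv_inv a f z) = z.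
Proof.
move=> [s sa fs].
exact: (@getPex _ [set s | 0 < s < a /\ derive1 f s = z]
  (ex_intro _ s (conj sa fs))).
Qed.

Lemma crossing_deriv_inv a (f : R -> R) : 
  (forall x y : R, 0 < x < a -> 0 < y < a -> x < y -> derive1 f x < derive1 f y) ->
  (forall z, exists2 s : R, 0 < s < a & derive1 f s = z) ->
  crossing a (derive1 f) (deriv_inv a f).
Proof.
move=> fi fs z; have [t0a ft] := deriv_invP (fs z).
split; first by move/andP: t0a => [/ltW -> /ltW ->].
by move=> c ca; split=> h; [rewrite -[ltRHS]ft|rewrite -[ltLHS]ft]; apply: fi.
Qed.

(** The one-sided limits in [trunc_deriv_inv] are the infimum and the supremum of
    f' on (0, a), by monotonicity; strict monotonicity keeps f' strictly
    between them, and the intermediate value theorem supplies the inverse. *)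
Lemma crossing_trunc_deriv_inv a (f : R -> R) : 0 < a ->
  (forall x y : R, 0 < x < a -> 0 < y < a -> x < y -> derive1 f x < derive1 f y) ->
  (forall c, 0 < c < a -> {for c, continuous (derive1 f)}) ->
  crossing a (derive1 f) (trunc_deriv_inv a f).
Proof.
move=> a0 fi fc.
have fle (x y : R) : 0 < x < a -> 0 < y < a -> x <= y -> derive1 f x <= derive1 f y.
  by move=> xa ya; rewrite le_eqVlt => /predU1P[->//|/fi H]; apply/ltW/H.
have ndf : {in Interval (BRight 0) (BLeft a) &, nondecreasing_fun (fun s => (derive1 f s)%:E)}.
  by move=> x y; rewrite !in_itv/= => xa ya xy; rewrite lee_fin fle.
have a0' : (BRight (0 : R) < BLeft a)%O by rewrite bnd_simp.
have Na0 : (BRight (- a) < BLeft (0 : R))%O by rewrite bnd_simp oppr_lt0.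
have niN : {in Interval (BRight (- a)) (BLeft 0) &,
    nonincreasing_fun ((fun s => (derive1 f s)%:E) \o -%R)}.
  by move=> x y; rewrite !in_itv/= => xa ya xy; rewrite lee_fin fle; lra.
have zlo := nondecreasing_at_right_cvge _ a0' ndf.
have zhi := (cvg_at_leftNP (fun s => (derive1 f s)%:E) a _).2
  (nonincreasing_at_right_cvge _ Na0 niN).
move: zlo zhi; set l := ereal_inf _; set h := ereal_sup _ => zlo zhi z.
rewrite /trunc_deriv_inv (cvg_lim _ zlo)// (cvg_lim _ zhi)//.
have lP c : 0 < c < a -> (l < (derive1 f c)%:E)%E.
  move=> ca; have c2 : 0 < c / 2 < a by lra.
  apply: (@le_lt_trans _ _ (derive1 f (c / 2))%:E); last by rewrite lte_fin fi//; lra.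
  by apply: ereal_inf_lbound; exists (c / 2) => //=; rewrite in_itv.
have hP c : 0 < c < a -> ((derive1 f c)%:E < h)%E.
  move=> ca; have c2 : 0 < (c + a) / 2 < a by lra.
  apply: (@lt_le_trans _ _ (derive1 f ((c + a) / 2))%:E); first by rewrite lte_fin fi//; lra.
  by apply: ereal_sup_ubound; exists (- ((c + a) / 2)) => /=; rewrite ?opprK// in_itv/=; lra.
case: ifPn => [hz|]; last rewrite -ltNge => zh.
  split; first by rewrite lexx ltW.
  move=> c ca; split=> [ca'|]; last by lra.
  by rewrite -lte_fin (lt_le_trans (hP _ ca)).
case: ifPn => [lz|]; last rewrite -ltNge => lz.
  split; first by rewrite lexx ltW.
  move=> c ca; split=> [|ca']; first by lra.
  by rewrite -lte_fin (le_lt_trans lz)// lP.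
have [t0a ft] : 0 < deriv_inv a f z < a /\ derive1 f (deriv_inv a f z) = z.
  apply: deriv_invP.
  have [_ [x + <-]] := ereal_inf_lt lz.
  rewrite /= in_itv/= lte_fin => xa xz.
  have [_ [y + <-]] := ereal_sup_gt zh.
  rewrite /= in_itv/= lte_fin => ya zy.
  have {}ya : 0 < - y < a by lra.
  have xy : x <= - y.
    by rewrite leNgt; apply/negP => /ltW/(fle _ _ ya xa); lra.
  have [||c] := @IVT _ (derive1 f) x (- y) z xy.
  - apply: continuous_in_subspaceT => c; rewrite inE/= in_itv/= => cxy.
    by apply: fc; lra.
  - by rewrite ge_min le_max (ltW xz) (ltW zy) orbT.
  - by rewrite in_itv/= => cxy cz; exists c => //; lra.
split; first by move/andP: t0a => [/ltW -> /ltW ->].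
by move=> c ca; split=> h'; [rewrite -[ltRHS]ft|rewrite -[ltLHS]ft]; apply: fi.
Unshelve. all: by end_near. Qed.

End crossing.
(** * Calculus on an interval *)

Section Ck_line.
Context {R : realType}.
Implicit Types (O K : set R) (f g : R -> R).

Lemma Ck_along_eq {E : normedModType R} (D : set E) k (O : set E) (f g : E -> R) :
  open O -> (forall x, O x -> f x = g x) ->
  Ck_along D k O O f -> Ck_along D k O O g.
Proof.
move=> oO fg; have nfg x : O x -> {near x, f =1 g}.
  by move=> Ox; near=> y; apply: fg; near: y; exact: open_nbhs_nbhs.
have cg : {within O, continuous f} -> {within O, continuous g}.
  by apply: subspace_eq_continuous => x /set_mem; exact: fg.
elim: k => [|k IH] [cf Hf]; split=> //; try exact: cg.
move=> v Dv; have [df [f' [f'E f'C]]] := Hf v Dv; split=> [x Ox|].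
  by apply: (near_eq_derivable (nfg _ Ox)); exact: df.
by exists f'; split=> // x Ox; rewrite f'E//; apply: near_eq_derive; exact: nfg.
Unshelve. all: by end_near. Qed.

Lemma Ck_is_derive k O K f x : Ck k.+1 O K f -> O x -> is_derive x (1 : R) f (derive1 f x).
Proof.
move=> [_ /(_ 1 Logic.I)[df _]] Ox.
by rewrite derive1E; apply/derivableP; exact: df.
Qed.

Lemma is_derive_continuous f df x : is_derive x (1 : R) f df -> {for x, continuous f}.
Proof. by move=> [H _]; exact/differentiable_continuous/derivable1_diffP. Qed.

Lemma Ck_derive1n j k O f : open O -> Ck (j + k) O O f -> Ck k O O (derive1n j f).
Proof.
move=> oO; elim: j k => [//|j IH] k; rewrite addSnnS => /IH.
move=> [_ /(_ 1 Logic.I)[_ [g [gE gC]]]].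
apply: (Ck_along_eq oO _ gC) => x Ox.
rewrite (gE x Ox).
rewrite derive1nS.
exact/esym/derive1E.
Qed.

Lemma Ck_continuous k O f x : open O -> Ck k O O f -> O x -> {for x, continuous f}.
Proof.
move=> oO /Ck_along_continuous; rewrite continuous_open_subspace// => H Ox.
by apply: H; rewrite inE.
Qed.

End Ck_line.

Section monotone.
Context {R : realType}.
Implicit Types (a x y s : R) (f df : R -> R).

Lemma MVT_oo a f df x y :
  (forall s, 0 < s < a -> is_derive s (1 : R) f (df s)) ->
  0 < x -> y < a -> x < y ->
  exists2 c : R, x < c < y & f y - f x = df c * (y - x).
Proof.
move=> dfs x0 ya xy; have dxy s : x <= s <= y -> is_derive s (1 : R) f (df s).
  by move=> sxy; apply: dfs; lra.
have [||c cxy ->] := @MVT _ f df x y xy.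
- by move=> c; rewrite in_itv/= => /andP[xc cy]; apply: dxy; rewrite !ltW.
- apply: continuous_in_subspaceT => c; rewrite inE/= in_itv/= => cxy.
  by apply: differentiable_continuous; apply/derivable1_diffP; have [] := dxy _ cxy.
- by exists c => //; move: cxy; rewrite in_itv.
Qed.

Lemma ae_itv_exists (P : R -> Prop) x y :
  {ae lebesgue_measure, forall s : R, P s} -> x < y ->
  exists2 s : R, x < s < y & P s.
Proof.
move=> [N [mN N0 PN]] xy; apply: contrapT => nP.
have : (lebesgue_measure (`]x, y[ : set R) <= lebesgue_measure N)%E.
  apply: le_measure; rewrite ?inE//.
  move=> s /=; rewrite in_itv/= => sxy; apply: PN => /= Ps; apply: nP.
  by exists s.
rewrite N0 leNgt => /negP; apply.
by rewrite lebesgue_measure_itv/= lte_fin xy -EFinB lte_fin subr_gt0.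
Qed.

(** A nondecreasing f with f x = f y is constant on [x, y], where its derivative
    would then vanish on a set of positive measure. *)
Lemma ae_pos_derive_lt a f df :
  (forall s, 0 < s < a -> is_derive s (1 : R) f (df s)) ->
  (forall s, 0 < s < a -> 0 <= df s) ->
  {ae lebesgue_measure, forall s : R, 0 < s < a -> 0 < df s} ->
  forall x y, 0 < x < a -> 0 < y < a -> x < y -> f x < f y.
Proof.
move=> dfs f0 aef x y xa ya xy.
have mono u v : x <= u -> v <= y -> u <= v -> f u <= f v.
  move=> xu vy; rewrite le_eqVlt => /predU1P[->//|uv].
  have [||c cuv E] := @MVT_oo a f df u v dfs _ _ uv; [lra|lra|].
  rewrite -subr_ge0 E mulr_ge0 ?f0 ?subr_ge0 ?ltW//; lra.
rewrite lt_neqAle; apply/andP; split; last by apply: mono => //; exact: ltW.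
apply/negP => /eqP fxy.
have [s sxy] := ae_itv_exists aef xy.
have sa : 0 < s < a by lra.
move=> /(_ sa); suff -> : df s = 0 by rewrite ltxx.
have [_ <-] := dfs _ sa.
rewrite (@near_eq_derive _ _ _ _ (cst (f x))) ?derive_cst//.
near=> t; apply/eqP; rewrite /= eq_le {1}fxy.
have xt : x < t by near: t; apply: lt_nbhsr; lra.
have ty : t < y by near: t; apply: lt_nbhsl; lra.
by rewrite !mono// ltW.
Unshelve. all: by end_near. Qed.

(** f - k ln is nondecreasing. *)
Lemma derive_ge_inv_ln a k f df b :
  0 < k -> 0 < b < a -> (forall s, 0 < s < a -> is_derive s (1 : R) f (df s)) ->
  (forall s, 0 < s < a -> k / s <= df s) ->
  forall s, 0 < s < b -> f s <= f b - k * ln b + k * ln s.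
Proof.
move=> k0 ba dfs fk s sb.
have dg t : 0 < t < a -> is_derive t (1 : R) (f - k *: @ln R) (df t - k *: t^-1).
  move=> ta; have dt := dfs _ ta.
  by have lt := is_derive1_ln (andP ta).1; exact: is_deriveB.
have [|||c cs] := @MVT_oo a _ _ s b dg; [lra|lra|lra|].
have : 0 <= (df c - k *: c^-1) * (b - s).
  apply: mulr_ge0; last by lra.
  by rewrite subr_ge0; apply: fk; lra.
by move=> /[swap] <-; rewrite !fctE /= /GRing.scale/=; lra.
Qed.

Lemma derive_ge_inv_unbounded a k f df :
  0 < a -> 0 < k -> (forall s, 0 < s < a -> is_derive s (1 : R) f (df s)) ->
  (forall s, 0 < s < a -> k / s <= df s) ->
  forall z : R, exists2 s : R, 0 < s < a & f s < z.
Proof.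
move=> a0 k0 dfs fk z; pose b := a / 2; have ba : 0 < b < a by rewrite /b; lra.
pose w := (z - 1 - (f b - k * ln b)) / k.
pose s := Num.min (b / 2) (expR w).
have sb : 0 < s < b.
  by rewrite lt_min expR_gt0 gt_min andbT; rewrite ltr_pdivrMr; lra.
exists s; first by lra.
have := derive_ge_inv_ln k0 ba dfs fk sb.
suff : k * ln s <= z - 1 - (f b - k * ln b) by lra.
have -> : z - 1 - (f b - k * ln b) = k * w by rewrite /w mulrCA mulfV ?mulr1// gt_eqF.
rewrite ler_pM2l// -[w]expRK ler_ln ?posrE ?expR_gt0//; last by case/andP: sb.
by rewrite ge_min lexx orbT.
Qed.

(** The reflection t |-> - f (a - t) exchanges the two end points. *)
Lemma derive_ge_inv_unbounded_right a k f df :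
  0 < a -> 0 < k -> (forall s, 0 < s < a -> is_derive s (1 : R) f (df s)) ->
  (forall s, 0 < s < a -> k / (a - s) <= df s) ->
  forall z : R, exists2 s : R, 0 < s < a & z < f s.
Proof.
move=> a0 k0 dfs fk z.
have dg t : 0 < t < a -> is_derive t (1 : R) (- (f \o (fun t => a - t))) (df (a - t)).
  move=> ta; have dt : is_derive (a - t) (1 : R) f (df (a - t)) by apply: dfs; lra.
  have da : is_derive t (1 : R) (fun t => a - t) (-1).
    by rewrite -[-1]sub0r; exact: is_deriveB.
  rewrite -[X in is_derive _ _ _ X]opprK; apply: is_deriveN.
  by rewrite -mulrN1; exact: is_derive1_comp.
have [|s sa fs] := derive_ge_inv_unbounded a0 k0 dg _ (- z).
- by move=> s sa; have := fk (a - s) ltac:(lra); rewrite opprB addrCA subrr addr0.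
- by exists (a - s); [lra|move: fs; rewrite !fctE ltrN2].
Qed.

Lemma IVT_oo a f z : (forall c, 0 < c < a -> {for c, continuous f}) ->
  (exists2 s : R, 0 < s < a & f s < z) -> (exists2 s : R, 0 < s < a & z < f s) ->
  exists2 s : R, 0 < s < a & f s = z.
Proof.
move=> cf [x xa fx] [y ya fy].
have [xy|yx] := leP x y.
- have [||c] := @IVT _ f x y z xy.
  + apply: continuous_in_subspaceT => c; rewrite inE/= in_itv/= => cxy.
    by apply: cf; lra.
  + by rewrite ge_min le_max (ltW fx) (ltW fy) orbT.
  + by rewrite in_itv/= => cxy cz; exists c => //; lra.
- have [||c] := @IVT _ f y x z (ltW yx).
  + apply: continuous_in_subspaceT => c; rewrite inE/= in_itv/= => cxy.
    by apply: cf; lra.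
  + by rewrite ge_min le_max (ltW fx) (ltW fy) orbT.
  + by rewrite in_itv/= => cxy cz; exists c => //; lra.
Qed.

(** The derivative of m extends continuously to the compact interval, hence is
    bounded, and m vanishes at both ends. *)
Lemma Ck_linear_bound a (m : R -> R) : 0 < a -> Ck 1 `]0, a[ `[0, a] m ->
  m 0 = 0 -> m a = 0 ->
  exists2 L : R, 0 < L & forall s, 0 < s < a -> m s <= L * s /\ m s <= L * (a - s).
Proof.
move=> a0 Cm m0 ma.
have cm := Ck_along_continuous Cm.
have [_ /(_ 1 Logic.I)[_ [g [gE [cg _]]]]] := Cm.
have [B B0 HB] := compact_continuous_bounded (@segment_compact R 0 a) cg.
exists (B + 1); first by lra.
have dm s : 0 < s < a -> is_derive s (1 : R) m (g s).
  move=> sa; rewrite gE/= ?in_itv//.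
  by rewrite -derive1E; apply: Ck_is_derive Cm _; rewrite /= in_itv.
have bound x y : 0 <= x -> y <= a -> x < y -> `|m y - m x| <= B * (y - x).
  move=> x0 ya xy; have [||c cxy ->] := @MVT _ m g x y xy.
  - by move=> c; rewrite in_itv/= => cxy; apply: dm; lra.
  - apply: continuous_subspaceW cm => c /=; rewrite !in_itv/=; lra.
  - move: cxy; rewrite in_itv/= => cxy.
    rewrite normrM (ger0_norm (_ : 0 <= y - x)); last by lra.
    by rewrite ler_wpM2r ?HB/= ?in_itv/=//; lra.
move=> s sa; split.
- have := bound 0 s (lexx _) ltac:(lra) ltac:(lra).
  rewrite m0 !subr0 => /ler_normlW; lra.
- have := bound s a ltac:(lra) (lexx _) ltac:(lra).
  rewrite ma sub0r normrN => /ler_normlW; lra.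
Qed.

(** f is only integrable up to the ends of (0, a), so the primitive based at 0 is
    used; the oriented integral differs from it by a constant on both sides of
    s0. *)
Lemma derive_oriented_integral a s0 (f : R -> R) :
  lebesgue_measure.-integrable `]0, a[ (EFin \o f) ->
  0 < s0 < a -> (forall c, 0 < c < a -> {for c, continuous f}) ->
  forall s, 0 < s < a -> derive1 (oriented_integral f s0) s = f s.
Proof.
move=> fi s0a cf s sa.
pose F (y : R) := \int[lebesgue_measure]_(t in `]0, y]) f t.
have ifi (y : R) : y < a -> lebesgue_measure.-integrable `]0, y] (EFin \o f).
  move=> ya; apply: integrableS fi => //.
  by move=> t /=; rewrite !in_itv/=; lra.
have E y : 0 < y < a -> oriented_integral f s0 y = F y - F s0.
  move=> ya; rewrite /oriented_integral /F; case: ifPn => [s0y|].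
    rewrite Rintegral_itvB ?bnd_simp//; [|by apply: ifi; lra|lra].
    by rewrite Rintegral_itv_bndo_bndc//; apply: integrableS fi => //;
      move=> t /=; rewrite !in_itv/=; lra.
  rewrite -ltNge => ys0; rewrite -[RHS]opprB.
  rewrite Rintegral_itvB ?bnd_simp//; [|by apply: ifi; lra|lra|lra].
  by rewrite Rintegral_itv_bndo_bndc//; apply: integrableS fi => //;
      move=> t /=; rewrite !in_itv/=; lra.
have su : s < (s + a) / 2 by lra.
have iu : lebesgue_measure.-integrable `]0, (s + a) / 2] (EFin \o f).
  by apply: ifi; lra.
have s0' : (BRight 0 < BRight s)%O by rewrite bnd_simp; lra.
have [dF F'] := @continuous_FTC1 _ f (BRight 0) s _ su iu s0' (cf s sa).
rewrite derive1E (@near_eq_derive _ _ _ _ (F - cst (F s0))).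
  rewrite deriveB; [|exact: dF|exact: derivable_cst].
  rewrite derive_cst subr0 -derive1E.
  exact: F'.
near=> y; apply: E.
by apply/andP; split; near: y; [apply: lt_nbhsr|apply: lt_nbhsl]; lra.
Unshelve. all: by end_near. Qed.

End monotone.
(** * The potentials U and Ue *)

Section potentials.
Context {R : realType} {d : nat}.
Variables (Om : set 'rV[R]_d) (alpha s0 : R) (m U : R -> R) (V : 'rV[R]_d -> R).
Hypothesis std : standing_assumptions Om alpha s0 m U V.
Local Notation Phi := (flux_potential m U s0).

Let oI : open (`]0, alpha[ : set R).
Proof. by apply: interval_open. Qed.
Let inI (s : R) : 0 < s < alpha -> (`]0, alpha[ : set R) s.
Proof. by move=> sa; rewrite /= in_itv. Qed.

Lemma U_is_derive s : 0 < s < alpha -> is_derive s (1 : R) U (derive1 U s).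
Proof. by move=> /inI; apply: Ck_is_derive (sa_U_C3 std). Qed.

Lemma U'_is_derive s : 0 < s < alpha ->
  is_derive s (1 : R) (derive1 U) (derive1n 2 U s).
Proof.
move=> /inI; have C : Ck 2 `]0, alpha[ `]0, alpha[ (derive1n 1 U).
  exact: (Ck_derive1n (j := 1) (k := 2) oI (sa_U_C3 std)).
exact: (Ck_is_derive C).
Qed.

Lemma U'_continuous s : 0 < s < alpha -> {for s, continuous (derive1 U)}.
Proof.
move=> /U'_is_derive[H _]; exact/differentiable_continuous/derivable1_diffP.
Qed.

Lemma U''_continuous s : 0 < s < alpha -> {for s, continuous (derive1n 2 U)}.
Proof.
move=> /inI; have C : Ck 1 `]0, alpha[ `]0, alpha[ (derive1n 2 U).
  exact: (Ck_derive1n (j := 2) (k := 1) oI (sa_U_C3 std)).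
exact: (Ck_continuous oI C).
Qed.

Lemma m_continuous s : 0 < s < alpha -> {for s, continuous m}.
Proof. by move=> /inI; exact: (Ck_continuous oI (sa_m_C1 std)). Qed.

Lemma derive1_flux_potential s : 0 < s < alpha ->
  derive1 Phi s = m s * derive1n 2 U s.
Proof.
move=> sa; apply: (derive_oriented_integral (a := alpha)) => //.
- exact: (sa_mU''_L1 std).
- by case: (sa_s0 std).
- move=> c ca; exact: (cvgM (m_continuous ca) (U''_continuous ca)).
Qed.

Hypothesis U''_gt0 : {ae lebesgue_measure, forall s : R,
    0 < s < alpha -> 0 < derive1n 2 U s}.

Lemma crossing_U : crossing alpha (derive1 U) (trunc_deriv_inv alpha U).
Proof.
apply: crossing_trunc_deriv_inv; first exact: (sa_alpha std).
- apply: (ae_pos_derive_lt (df := derive1n 2 U)).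
  + exact: U'_is_derive.
  + exact: (sa_U_convex std).
  + exact: U''_gt0.
- exact: U'_continuous.
Qed.

Variables (kappa : R -> R) (Phie me Ue : R -> R -> R).
Hypothesis reg : regularisation alpha s0 m U kappa Phie me Ue.

Section fixed_eps.
Variable (eps : R).
Hypothesis eps01 : 0 < eps <= 1.

Lemma Ue_is_derive j s : (j < 3)%N -> 0 < s < alpha ->
  is_derive s (1 : R) (derive1n j (Ue eps)) (derive1n j.+1 (Ue eps) s).
Proof.
move=> j3 /inI; have [C _] := rg_Ue_C31 reg eps01.
have {}C : Ck (2 - j).+1 `]0, alpha[ `]0, alpha[ (derive1n j (Ue eps)).
  by apply: Ck_derive1n oI _; rewrite -subSn// subnKC// ltnW.
rewrite derive1nS; exact: Ck_is_derive C.
Qed.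

Lemma Ue'''_continuous s : 0 < s < alpha -> {for s, continuous (derive1n 3 (Ue eps))}.
Proof.
move=> /inI; have [C _] := rg_Ue_C31 reg eps01.
exact: (Ck_continuous oI (Ck_derive1n (j := 3) (k := 0) oI C)).
Qed.

(** The lower bound g of Phie' is at least eps because Phi' = m U'' >= 0. *)
Lemma Phie'_ge s : 0 < s < alpha -> eps <= derive1 (Phie eps) s.
Proof.
move=> sa; have /andP[+ _] := rg_Phie_bounds reg eps01 sa.
apply: le_trans; rewrite lerDr le_min derive1_flux_potential//.
rewrite mulr_ge0 ?(sa_U_convex std)//; last by rewrite ltW// (sa_m_pos std).
by rewrite invr_ge0 ltW// (rg_kappa_gt0 reg).
Qed.

Lemma Ue''_gt0 s : 0 < s < alpha -> 0 < derive1n 2 (Ue eps) s.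
Proof.
move=> sa; rewrite (rg_Ue'' reg)// divr_gt0 ?(rg_me_pos reg)//.
by apply: lt_le_trans (Phie'_ge sa); case/andP: eps01.
Qed.

Lemma Ue'_lt x y : 0 < x < alpha -> 0 < y < alpha -> x < y ->
  derive1 (Ue eps) x < derive1 (Ue eps) y.
Proof.
move=> xa ya xy; rewrite -subr_gt0.
have [||c cxy ->] := @MVT_oo _ alpha (derive1 (Ue eps)) (derive1n 2 (Ue eps)) x y
  (fun s sa => Ue_is_derive (j := 1) isT sa) _ _ xy; [lra|lra|].
by rewrite mulr_gt0 ?subr_gt0// Ue''_gt0//; lra.
Qed.

Lemma Ue'_continuous s : 0 < s < alpha -> {for s, continuous (derive1 (Ue eps))}.
Proof.
move=> sa; have [H _] := Ue_is_derive (j := 1) isT sa.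
exact/differentiable_continuous/derivable1_diffP.
Qed.

(** Ue'' = Phie'/me >= eps / (L s) near 0, and symmetrically near alpha, so Ue'
    diverges logarithmically at both ends. *)
Lemma Ue'_surj z : exists2 s : R, 0 < s < alpha & derive1 (Ue eps) s = z.
Proof.
have a0 := sa_alpha std; have e0 : 0 < eps by case/andP: eps01.
have [m0 ma] := rg_me_bdry reg eps01.
have [L L0 HL] := Ck_linear_bound a0 (rg_me_C1 reg eps01) m0 ma.
have dU s : 0 < s < alpha -> is_derive s (1 : R) (derive1 (Ue eps)) (derive1n 2 (Ue eps) s).
  exact: (Ue_is_derive (j := 1) isT).
have lb s t : 0 < s < alpha -> 0 < t -> me eps s <= L * t ->
    eps / L / t <= derive1n 2 (Ue eps) s.
  move=> sa t0 mt; rewrite (rg_Ue'' reg)// -mulrA -invfM.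
  have mp := rg_me_pos reg eps01 sa.
  apply: ler_pM; [exact: ltW|by rewrite invr_ge0 ltW ?mulr_gt0|exact: Phie'_ge|].
  by rewrite lef_pV2 ?posrE ?mulr_gt0.
apply: IVT_oo; first exact: Ue'_continuous.
- apply: (derive_ge_inv_unbounded a0 (divr_gt0 e0 L0) dU) => s sa.
  by apply: lb => //; [case/andP: sa|case: (HL s sa)].
- apply: (derive_ge_inv_unbounded_right a0 (divr_gt0 e0 L0) dU) => s sa.
  by apply: lb => //; [lra|case: (HL s sa)].
Qed.

Lemma crossing_Ue : crossing alpha (derive1 (Ue eps)) (deriv_inv alpha (Ue eps)).
Proof. exact: crossing_deriv_inv Ue'_lt Ue'_surj. Qed.

Local Notation h := (deriv_inv alpha (Ue eps)).

Lemma deriv_inv_UeP z : 0 < h z < alpha /\ derive1 (Ue eps) (h z) = z.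
Proof. exact/deriv_invP/Ue'_surj. Qed.

Lemma deriv_inv_UeK s : 0 < s < alpha -> h (derive1 (Ue eps) s) = s.
Proof.
move=> sa; have [ha E] := deriv_inv_UeP (derive1 (Ue eps) s).
have [//|] := eqVneq (h (derive1 (Ue eps) s)) s.
rewrite neq_lt => /orP[hs|hs].
  by have := Ue'_lt ha sa hs; rewrite E ltxx.
by have := Ue'_lt sa ha hs; rewrite E ltxx.
Qed.

Lemma is_derive_deriv_inv_Ue z :
  is_derive z (1 : R) h (derive1n 2 (Ue eps) (h z))^-1.
Proof.
have [ha E] := deriv_inv_UeP z; rewrite -{1}E.
have near_in : \forall s \near h z, 0 < s < alpha.
  by near=> s; apply/andP; split; near: s; [apply: lt_nbhsr|apply: lt_nbhsl]; case/andP: ha.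
apply: is_derive_inverse.
- by near=> s; apply: deriv_inv_UeK; near: s.
- by near=> s; apply: Ue'_continuous; near: s.
- exact: (Ue_is_derive (j := 1) isT ha).
- by rewrite gt_eqF// Ue''_gt0.
Unshelve. all: by end_near. Qed.

(** (Ue')^-1 with its first two derivatives, in the form used by
    [Ck_along_comp]. *)
Definition deriv_inv_jet (i : nat) : R -> R :=
  match i with
  | 0 => h
  | 1 => fun z => (derive1n 2 (Ue eps) (h z))^-1
  | _ => fun z => - (derive1n 2 (Ue eps) (h z)) ^- 2 *:
                  (derive1n 3 (Ue eps) (h z) * (derive1n 2 (Ue eps) (h z))^-1)
  end.

Lemma deriv_inv_jetP i z : (i < 2)%N ->
  is_derive z (1 : R) (deriv_inv_jet i) (deriv_inv_jet i.+1 z).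
Proof.
case: i => [_|[_|//]]; first exact: is_derive_deriv_inv_Ue.
have [ha _] := deriv_inv_UeP z.
apply: is_deriveV; first by rewrite gt_eqF// Ue''_gt0.
apply: (@is_derive1_comp _ (derive1n 2 (Ue eps)) h).
  exact: (Ue_is_derive (j := 2) isT ha).
exact: is_derive_deriv_inv_Ue.
Qed.

Lemma deriv_inv_jet_continuous i : (i <= 2)%N ->
  continuous (deriv_inv_jet i).
Proof.
have dc j : (j < 2)%N -> continuous (deriv_inv_jet j).
  move=> j2 z; have [H _] := deriv_inv_jetP z j2.
  exact/differentiable_continuous/derivable1_diffP.
rewrite leq_eqVlt => /predU1P[->|/dc//] z.
have [ha _] := deriv_inv_UeP z.
have c1 := dc 1%N isT z; have c0 := dc 0%N isT z.
have c3 : {for z, continuous (derive1n 3 (Ue eps) \o h)}.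
  by apply: continuous_comp; [exact: c0|exact: Ue'''_continuous].
have -> : deriv_inv_jet 2 = - (deriv_inv_jet 1 * deriv_inv_jet 1) *
    ((derive1n 3 (Ue eps) \o h) * deriv_inv_jet 1).
  by apply/funext => y; rewrite /= /GRing.scale/= !fctE expr2 invfM.
exact: (cvgM (cvgN (cvgM c1 c1)) (cvgM c3 c1)).
Qed.

End fixed_eps.

(** Convergence is stated jointly in the point and in eps, the form from which
    compactness yields uniform convergence on segments.  The joint continuity of
    me down to eps = 0 and the uniform convergence of Phie' on segments are used
    here. *)
Lemma Ue''_cvg t : 0 < t < alpha ->
  (derive1n 2 (Ue p.2) p.1 - derive1n 2 U p.1) @[p --> filter_prod (nbhs t) (0 : R)^'+] --> (0 : R).
Proof.
move=> ta; set G := filter_prod _ _.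
have near_in : \forall p \near G, 0 < p.1 < alpha.
  have : \forall s \near t, 0 < s < alpha.
    by near=> s; apply/andP; split; near: s; [apply: lt_nbhsr|apply: lt_nbhsl]; case/andP: ta.
  exact: cvg_fst.
have near_eps : \forall p \near G, 0 < p.2 <= 1.
  have : \forall e \near (0 : R)^'+, 0 < e <= 1.
    by near=> e; apply/andP; split; near: e; [exact: nbhs_right_gt|exact: nbhs_right_le].
  exact: cvg_snd.
have cm : me p.2 p.1 @[p --> G] --> m t.
  have [/subspace_continuousP/(_ (0, t)) + _] := rg_me_joint reg.
  set A := (X in within X); set mE := (X in from_subspace _ X).
  have At : A (0, t) by rewrite /A/=; split; lra.
  move=> /(_ At) H W nW.
  have mE0 : mE (0, t) = m t by rewrite /mE/= eqxx.
  have [[B C] [/= nB nC] BC] : nbhs ((0 : R), t) [set p : R * R | A p -> W (mE p)].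
    by apply: H; change (nbhs (mE (0, t)) W); rewrite mE0.
  have near_B : \forall p \near G, B p.2.
    have : \forall e \near (0 : R)^'+, B e by exact: cvg_within.
    exact: cvg_snd.
  have near_C : \forall p \near G, C p.1 by exact: (cvg_fst nC).
  change (\forall p \near G, W (me p.2 p.1)).
  near=> p.
  have p2 : 0 < p.2 <= 1 by near: p.
  have p1 : 0 < p.1 < alpha by near: p.
  have Bp : B p.2 by near: p.
  have Cp : C p.1 by near: p.
  have := BC (p.2, p.1) (conj Bp Cp).
  rewrite /mE /A /= gt_eqF; last by case/andP: p2.
  by apply; split; lra.
have c1 (f : R -> R) : {for t, continuous f} -> f p.1 @[p --> G] --> f t.
  by move=> cf; apply: (cvg_comp _ _ (@cvg_fst _ _ _ _ _)); exact: cf.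
have cPhi' : {for t, continuous (derive1 Phi)}.
  apply: (near_eq_continuous (g := fun s => m s * derive1n 2 U s)).
    by near=> s; rewrite derive1_flux_potential//; apply/andP; split; near: s;
     [apply: lt_nbhsr|apply: lt_nbhsl]; case/andP: ta.
  exact: (cvgM (m_continuous ta) (U''_continuous ta)).
have cP : derive1 (Phie p.2) p.1 @[p --> G] --> derive1 Phi t.
  have -> : derive1 Phi t = 0 + derive1 Phi t by rewrite add0r.
  rewrite (_ : (fun p => _) = (fun p : R * R =>
    (derive1 (Phie p.2) p.1 - derive1 Phi p.1) + derive1 Phi p.1)); last first.
    by apply/funext => p; rewrite subrK.
  apply: cvgD; last exact: c1.
  apply/cvgr0Pnorm_le => e e0.
  have near_cv : \forall p \near G, forall s : R, t / 2 <= s <= (t + alpha) / 2 ->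
      `|derive1n 1 (Phie p.2) s - derive1n 1 Phi s| <= e.
    have : \forall eps \near (0 : R)^'+, forall s : R, t / 2 <= s <= (t + alpha) / 2 ->
      `|derive1n 1 (Phie eps) s - derive1n 1 Phi s| <= e.
      have t2 : 0 < t / 2 by lra.
      have ta2 : (t + alpha) / 2 < alpha by lra.
      exact: (rg_Phie_cvg reg (j := 1%N) isT t2 ta2 e0).
    exact: cvg_snd.
  have near_t : \forall p \near G, t / 2 <= p.1 <= (t + alpha) / 2.
    have : \forall s \near t, t / 2 <= s <= (t + alpha) / 2.
      near=> s; apply/andP; split; apply/ltW; near: s.
        by apply: lt_nbhsr; lra.
      by apply: lt_nbhsl; lra.
    exact: cvg_fst.
  near=> p; apply: (near near_cv p _ p.1 (near near_t p _)) => //.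
have mt : m t != 0 by rewrite gt_eqF// (sa_m_pos std).
have -> : 0 = derive1 Phi t * (m t)^-1 - derive1n 2 U t.
  by rewrite derive1_flux_potential// mulrAC mulfV// mul1r subrr.
apply: cvg_trans (cvgB (cvgM cP (cvgV mt cm)) (c1 _ (U''_continuous ta))).
apply: near_eq_cvg; near=> p.
have p2 : 0 < p.2 <= 1 by near: p.
have p1 : 0 < p.1 < alpha by near: p.
by rewrite (rg_Ue'' reg p2 p1).
Unshelve. all: by end_near. Qed.

(** Both derivatives agree at alpha/2, and Ue'' - U'' is uniformly small on the
    segment between alpha/2 and s. *)
Lemma Ue'_cvg s : 0 < s < alpha ->
  derive1 (Ue eps) s @[eps --> 0^'+] --> derive1 U s.
Proof.
move=> sa; have a0 := sa_alpha std; set a2 := alpha / 2.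
have a2a : 0 < a2 < alpha by rewrite /a2; lra.
pose lo := Num.min s a2; pose hi := Num.max s a2.
have loP : 0 < lo by rewrite lt_min; lra.
have hiP : hi < alpha by rewrite gt_max; lra.
apply/cvgrPdist_le => e e0.
have : \forall eps \near (0 : R)^'+, `[lo, hi] `<=`
    [set t | `|derive1n 2 (Ue eps) t - derive1n 2 U t| <= e / alpha].
  have /compact_near_coveringP := @segment_compact R lo hi; apply.
  move=> t /=; rewrite in_itv/= => tlh.
  have /Ue''_cvg/cvgr0Pnorm_le : 0 < t < alpha by lra.
  by apply; rewrite divr_gt0.
move=> H; near=> eps.
have eps01 : 0 < eps <= 1.
  by apply/andP; split; near: eps; [exact: nbhs_right_gt|exact: nbhs_right_le].
have HB : `[lo, hi] `<=` [set t | `|derive1n 2 (Ue eps) t - derive1n 2 U t| <= e / alpha].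
  by near: eps.
pose w := derive1 U - derive1 (Ue eps).
have w0 : w a2 = 0 by rewrite /w !fctE (rg_Ue_mid reg eps01).2 subrr.
have dw t : 0 < t < alpha -> is_derive t (1 : R) w (derive1n 2 U t - derive1n 2 (Ue eps) t).
  move=> ta; have d1 := U'_is_derive ta.
  by have d2 := Ue_is_derive eps01 (j := 1) isT ta; exact: is_deriveB.
have bound x y : 0 < x -> y < alpha -> x < y -> lo <= x -> y <= hi -> `|w y - w x| <= e.
  move=> x0 ya xy lx yh; have [c cxy ->] := MVT_oo dw x0 ya xy.
  have : (`[lo, hi] : set R) c by rewrite /= in_itv/=; lra.
  move=> /HB/=; rewrite distrC normrM => H1.
  rewrite (_ : e = e / alpha * alpha); last by rewrite divfK// gt_eqF.
  by rewrite ler_pM// ger0_norm; lra.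
rewrite -[leLHS]/(`|w s|).
have [sa2|sa2|->] := ltgtP s a2; last by rewrite w0 normr0 ltW.
- rewrite -normrN -[- w s]add0r -{1}w0; apply: bound => //; try lra.
  + by rewrite ge_min lexx.
  + by rewrite le_max lexx orbT.
- rewrite -[w s]subr0 -{1}w0; apply: bound => //; try lra.
  + by rewrite ge_min lexx orbT.
  + by rewrite le_max lexx.
Unshelve. all: by end_near. Qed.

End potentials.
(** * The mass as a function of the level *)

Section mass.
Context {R : realType} {n : nat}.
Variables (Om : set 'rV[R]_n) (a : R) (V : 'rV[R]_n -> R).
Local Notation mu := (@lebesgue_rV R n).
Hypotheses (oOm : open Om) (Omoo : (mu Om < +oo)%E).
Hypothesis cV : {within Om, continuous V}.

Let mOm : measurable Om. Proof. exact: open_measurable_rV. Qed.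

Lemma bounded_dominated_convergence (g_ : nat -> 'rV[R]_n -> R) (g : 'rV[R]_n -> R) :
  (forall k, measurable_fun Om (g_ k)) -> measurable_fun Om g ->
  (forall k x, Om x -> `|g_ k x| <= a) ->
  (forall x, Om x -> g_ k x @[k --> \oo] --> g x) ->
  (\int[mu]_(x in Om) `|g_ k x - g x|%:E @[k --> \oo] --> 0)%E /\
  (\int[mu]_(x in Om) (g_ k x)%:E @[k --> \oo] --> \int[mu]_(x in Om) (g x)%:E)%E.
Proof.
move=> mg_ mg ga gg.
have [] := @dominated_convergence _ _ _ mu Om mOm (fun k x => (g_ k x)%:E)
  (fun x => (g x)%:E) (cst a%:E).
- by move=> k; exact/measurable_EFinP.
- exact/measurable_EFinP.
- by apply: aeW => x Ox; apply: cvg_EFin; [exact: nearW|exact: gg].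
- by apply: (bounded_integrable (f := cst a) (B := `|a|)).
- by apply: aeW => x k Ox; rewrite lee_fin ga.
- by move=> _ H1 H2; split.
Qed.

Variables (f T : R -> R).
Hypothesis cT : crossing a f T.

Lemma crossing_comp_continuous C : {within Om, continuous (fun x => T (C - V x))}.
Proof.
apply: (@within_continuous_comp _ _ _ (fun x => C - V x) T).
  by move=> x; apply: cvgB; [exact: cvg_cst|exact: cV].
by move=> x _; exact: (crossing_continuous cT).
Qed.

Lemma crossing_comp_measurable C : measurable_fun Om (fun x => T (C - V x)).
Proof. apply: continuous_measurable_rV => //; exact: crossing_comp_continuous. Qed.

Lemma crossing_comp_norm z : `|T z| <= a.
Proof. by have [/andP[T0 Ta] _] := cT z; rewrite ger0_norm. Qed.

Lemma crossing_comp_integrable C : mu.-integrable Om (EFin \o (fun x => T (C - V x))).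
Proof.
apply: (bounded_integrable (B := a)) => //; first exact: crossing_comp_measurable.
by move=> x _; exact: crossing_comp_norm.
Qed.

Local Notation J C := (\int[mu]_(x in Om) T (C - V x)).

Lemma mass_Rintegral C : (\int[mu]_(x in Om) (T (C - V x))%:E)%E = (J C)%:E.
Proof.
rewrite /Rintegral fineK//; apply: integrable_fin_num => //.
exact: crossing_comp_integrable.
Qed.

Lemma mass_le C1 C2 : C1 <= C2 -> J C1 <= J C2.
Proof.
move=> C12; apply: le_Rintegral => //; try exact: crossing_comp_integrable.
by move=> x _; apply: crossing_le cT _; lra.
Qed.

End mass.

Section mass_convergence.
Context {R : realType} {n : nat}.
Variables (Om : set 'rV[R]_n) (a : R) (V : 'rV[R]_n -> R).
Local Notation mu := (@lebesgue_rV R n).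
Hypotheses (oOm : open Om) (Omoo : (mu Om < +oo)%E).
Hypothesis cV : {within Om, continuous V}.

Lemma crossing_comp_cvg (f_ T_ : nat -> R -> R) (C_ : nat -> R) f T (C : R) :
  (forall k, crossing a (f_ k) (T_ k)) -> crossing a f T ->
  (forall c, 0 < c < a -> f_ k c @[k --> \oo] --> f c) ->
  C_ k @[k --> \oo] --> C ->
  L1dist Om (fun x => T_ k (C_ k - V x)) (fun x => T (C - V x)) @[k --> \oo] --> 0%E /\
  \int[mu]_(x in Om) T_ k (C_ k - V x) @[k --> \oo] --> \int[mu]_(x in Om) T (C - V x).
Proof.
move=> cT_ cT ff CC.
have [||||H1 H2] := @bounded_dominated_convergence _ _ Om a oOm Omoo
  (fun k x => T_ k (C_ k - V x)) (fun x => T (C - V x)).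
- by move=> k; apply: crossing_comp_measurable (cT_ k) _.
- exact: crossing_comp_measurable cT _.
- by move=> k x _; exact: crossing_comp_norm (cT_ k) _.
- move=> x _; apply: (@crossing_cvg _ _ \oo _ a f_ T_ (fun k => C_ k - V x) f T) => //.
    exact: nearW.
  by apply: cvgB => //; exact: cvg_cst.
split; first exact: H1.
apply: fine_cvg; rewrite -(mass_Rintegral oOm Omoo cV cT); exact: H2.
Qed.

Lemma mass_continuous f T : crossing a f T ->
  continuous (fun C => \int[mu]_(x in Om) T (C - V x)).
Proof.
move=> cT C.
apply/left_right_continuousP.
split; [apply/cvg_at_leftP|apply/cvg_at_rightP] => u [_ uC];
apply: (crossing_comp_cvg (f_ := fun=> f) (T_ := fun=> T) _ cT _ uC).2 => //;
by move=> c _; exact: cvg_cst.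
Qed.

(** The mass is continuous in the level and tends to 0 and to a |Om| along the
    levels - k and k, so the intermediate value theorem applies. *)
Lemma mass_exists f T M : 0 < a -> crossing a f T ->
  0 < M -> (M%:E < a%:E * mu Om)%E ->
  exists C, \int[mu]_(x in Om) T (C - V x) = M.
Proof.
move=> a0 cT M0 Ma; pose J C := \int[mu]_(x in Om) T (C - V x).
have mO := open_measurable_rV oOm.
have muE : mu Om = (fine (mu Om))%:E by rewrite fineK// ge0_fin_numE.
have lim (z_ : nat -> R) (l : R) :
    (forall x, T (z_ k - V x) @[k --> \oo] --> l) ->
    J (z_ k) @[k --> \oo] --> l * fine (mu Om).
  move=> H; rewrite -(Rintegral_cst mu mO l).
  have [||||_] := @bounded_dominated_convergence _ _ Om a oOm Omoo
    (fun k x => T (z_ k - V x)) (fun x => l).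
  - by move=> k; exact: (crossing_comp_measurable oOm cV cT).
  - exact: measurable_cst.
  - by move=> k x _; exact: crossing_comp_norm cT _.
  - by move=> x _; exact: H.
  move=> {}H; apply: fine_cvg; rewrite fineK//.
  apply: integrable_fin_num => //.
  exact: (bounded_integrable (f := cst l) (B := `|l|)).
have nn x : (k%:R - V x) @[k --> \oo] --> +oo.
  apply/cvgryPgt => A; near=> k; rewrite ltrBrDr.
  by near: k; exact: nbhs_infty_gtr.
have nN x : (- k%:R - V x) @[k --> \oo] --> -oo.
  apply/cvgrNyPlt => A; near=> k; rewrite ltrBlDr ltrNl.
  by near: k; exact: nbhs_infty_gtr.
have [k Jk] : exists k : nat, M < J k%:R.
  have Ma' : M < a * fine (mu Om) by move: Ma; rewrite muE -EFinM lte_fin.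
  have JC : J k%:R @[k --> \oo] --> a * fine (mu Om).
    by apply: lim => x; exact: crossing_cvg_pinfty a0 cT (nn x).
  have [k _ /(_ k (leqnn _))] := cvgr_gt _ JC _ Ma'.
  by exists k.
have [l Jl] : exists l : nat, J (- l%:R) < M.
  have JC : J (- k%:R) @[k --> \oo] --> 0.
    by rewrite -(mul0r (fine (mu Om))); apply: lim => x; exact: crossing_cvg_ninfty a0 cT (nN x).
  have [l _ /(_ l (leqnn _))] := cvgr_lt _ JC _ M0.
  by exists l.
have [|||C _ JC] := @IVT _ J (- l%:R) k%:R M; last by exists C.
- by rewrite (@le_trans _ _ 0) ?oppr_le0.
- by apply: continuous_subspaceT; exact: mass_continuous cT.
- by rewrite ge_min le_max (ltW Jk) (ltW Jl) orbT.
Unshelve. all: by end_near. Qed.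

(** Equal masses force equal states, first almost everywhere and then everywhere,
    as the set where they differ is open.  A value taken by T at two levels is 0
    or a, and a state with values in {0, a} is constant on the connected set Om. *)
Lemma mass_inj f T M C1 C2 : 0 < a -> connected Om ->
  crossing a f T -> (forall c, 0 < c < a -> {for c, continuous f}) ->
  0 < M -> (M%:E < a%:E * mu Om)%E ->
  \int[mu]_(x in Om) T (C1 - V x) = M -> \int[mu]_(x in Om) T (C2 - V x) = M ->
  C1 = C2.
Proof.
move=> a0 connOm cT cf M0 Ma.
wlog C12 : C1 C2 / C1 < C2.
  move=> H J1 J2; have [C12|C12|//] := ltgtP C1 C2; first exact: H.
  exact/esym/H.
move=> J1 J2; exfalso.
have mO := open_measurable_rV oOm.
have I1 := crossing_comp_integrable oOm Omoo cV cT C1.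
have I2 := crossing_comp_integrable oOm Omoo cV cT C2.
pose D x := T (C2 - V x) - T (C1 - V x).
have D0 x : 0 <= D x by rewrite subr_ge0; apply: crossing_le cT _; lra.
have cD : {within Om, continuous D}.
  by move=> x; apply: cvgB; exact: (crossing_comp_continuous cV cT).
have intD : (\int[mu]_(x in Om) `|(D x)%:E| = 0)%E.
  under eq_integral do rewrite gee0_abs ?lee_fin//.
  rewrite /D; under eq_integral do rewrite EFinB.
  rewrite integralB// (mass_Rintegral oOm Omoo cV cT) (mass_Rintegral oOm Omoo cV cT).
  by rewrite J1 J2 subee.
have aeD : ae_eq mu Om (EFin \o D) (cst 0%E).
  apply/(ae_eq_integral_abs _ mO) => //.
  by apply/measurable_EFinP; exact: continuous_measurable_rV.
have DE x : Om x -> D x = 0.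
  move=> Ox; apply: contrapT => /eqP Dx.
  pose P := Om `&` [set x | 0 < D x].
  have oP : open P.
    rewrite openE => y [Oy Dy]; apply: filterI; first exact: open_nbhs_nbhs.
    move: cD; rewrite continuous_open_subspace// => /(_ y (mem_set Oy)) cDy.
    exact: (cvgr_gt _ cDy).
  have : (0 < mu P)%E.
    by apply: lebesgue_rV_open_gt0 => //; exists x; split=> //=; rewrite lt_neqAle eq_sym Dx D0.
  have [N [mN N0 DN]] := aeD.
  have : (mu P <= mu N)%E.
    apply: le_measure; rewrite ?inE//; first exact: open_measurable_rV.
    by move=> y [Oy Dy]; apply: DN => /= /(_ Oy) [E]; move: Dy; rewrite /= E ltxx.
  by rewrite N0 leNgt => /negP.
have flat x : Om x -> T (C1 - V x) = 0 \/ T (C1 - V x) = a.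
  move=> Ox; apply: (crossing_flat cT cf (z2 := C2 - V x)); first by lra.
  by apply/eqP; rewrite eq_sym -subr_eq0 -/(D x) DE.
have /connected_intervalP itv := connected_continuous_connected connOm
  (crossing_comp_continuous cV cT (C := C1)).
have [[y Oy ya]|na] := pselect (exists2 x, Om x & T (C1 - V x) = a); last first.
  have : \int[mu]_(x in Om) T (C1 - V x) = \int[mu]_(x in Om) 0.
    apply: eq_Rintegral => x /set_mem Ox.
    by have [//|xa] := flat _ Ox; case: na; exists x.
  by rewrite J1 Rintegral_cst// mul0r => M00; move: M0; rewrite M00 ltxx.
have [[x Ox x0]|n0] := pselect (exists2 x, Om x & T (C1 - V x) = 0).
  have [w Ow wE] : ((fun x => T (C1 - V x)) @` Om) (a / 2).
    by apply: (itv 0 a); [exists x|exists y|lra].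
  have [] := flat _ Ow; rewrite wE => E; lra.
have : (\int[mu]_(x in Om) (T (C1 - V x))%:E = a%:E * mu Om)%E.
  rewrite -integral_cst//; apply: eq_integral => x /set_mem Ox.
  by have [xa|->//] := flat _ Ox; case: n0; exists x.
by rewrite (mass_Rintegral oOm Omoo cV cT) J1 => E; move: Ma; rewrite E ltxx.
Qed.

(** At C - e the limit mass is less than M, and so are the approximating masses
    eventually; monotonicity places C_ k to the right of C - e. *)
Lemma mass_level_cvg (f_ T_ : nat -> R -> R) (C_ : nat -> R) f T (C : R) M :
  (forall k, crossing a (f_ k) (T_ k)) -> crossing a f T ->
  (forall c, 0 < c < a -> f_ k c @[k --> \oo] --> f c) ->
  (forall k, \int[mu]_(x in Om) T_ k (C_ k - V x) = M) ->
  \int[mu]_(x in Om) T (C - V x) = M ->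
  (forall C', \int[mu]_(x in Om) T (C' - V x) = M -> C' = C) ->
  C_ k @[k --> \oo] --> C.
Proof.
move=> cT_ cT ff JM JC Juniq.
have J_cvg C' : \int[mu]_(x in Om) T_ k (C' - V x) @[k --> \oo] -->
    \int[mu]_(x in Om) T (C' - V x).
  exact: (crossing_comp_cvg cT_ cT ff (cvg_cst C')).2.
have J_ne C' : C' != C -> \int[mu]_(x in Om) T (C' - V x) != M.
  by apply: contra_neq => /Juniq.
apply/cvgrPdist_lt => e e0.
have lM : \int[mu]_(x in Om) T (C - e - V x) < M.
  rewrite lt_neqAle J_ne/=; last by rewrite lt_eqF//; lra.
  by rewrite -JC; apply: (mass_le oOm Omoo cV cT); lra.
have uM : M < \int[mu]_(x in Om) T (C + e - V x).
  rewrite lt_neqAle eq_sym J_ne/=; last by rewrite gt_eqF//; lra.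
  by rewrite -JC; apply: (mass_le oOm Omoo cV cT); lra.
near=> k; rewrite ltr_distlC; apply/andP; split.
- have : \int[mu]_(x in Om) T_ k (C - e - V x) < M.
    by near: k; exact: (cvgr_lt _ (J_cvg (C - e)) _ lM).
  by rewrite ltNge -(JM k); apply: contraNT; rewrite -leNgt => /(mass_le oOm Omoo cV (cT_ k)).
- have : M < \int[mu]_(x in Om) T_ k (C + e - V x).
    by near: k; exact: (cvgr_gt _ (J_cvg (C + e)) _ uM).
  by rewrite ltNge -(JM k); apply: contraNT; rewrite -leNgt => /(mass_le oOm Omoo cV (cT_ k)).
Unshelve. all: by end_near. Qed.

End mass_convergence.
(** * Stationary solutions of the regularised problem *)

Section stationary.
Context {R : realType} {d : nat}.
Variables (Om : set 'rV[R]_d) (alpha s0 : R) (m U : R -> R) (V : 'rV[R]_d -> R).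
Hypothesis std : standing_assumptions Om alpha s0 m U V.
Local Notation mu := (@lebesgue_rV R d).

Lemma closure_bounded_compact (A : set 'rV[R]_d) : bounded_set A -> compact (closure A).
Proof.
move=> [B [_ HB]]; apply: bounded_closed_compact; last exact: closed_closure.
exists B; split; first exact: num_real.
move=> r Br; have cl : closed [set x : 'rV[R]_d | `|x| <= r].
  apply: (@closed_comp _ _ (fun x : 'rV[R]_d => `|x|) [set y | y <= r]).
    by move=> x _; exact: norm_continuous.
  exact: closed_le.
have sub : A `<=` [set x : 'rV[R]_d | `|x| <= r] by move=> x; exact: HB.
by move=> x /(closureS sub); rewrite -(closure_id _).1.
Qed.

Lemma domain_open : open Om. Proof. by case: (sa_domain std). Qed.

Lemma domain_finite : (mu Om < +oo)%E.
Proof.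
case: (sa_domain std) => oO _ bO _; apply: lebesgue_rV_bounded bO.
exact: open_measurable_rV.
Qed.

Lemma closure_domain_compact : compact (closure Om).
Proof. by case: (sa_domain std) => _ _ bO _; exact: closure_bounded_compact. Qed.

Lemma V_continuous : {within closure Om, continuous V}.
Proof. exact: Ck_along_continuous (sa_V_C2 std). Qed.

Lemma V_continuous_domain : {within Om, continuous V}.
Proof. by apply: continuous_subspaceW V_continuous; exact: subset_closure. Qed.

Lemma V_bounded : exists2 B : R, 0 <= B & forall x, closure Om x -> `|V x| <= B.
Proof. exact: compact_continuous_bounded closure_domain_compact V_continuous. Qed.

Lemma crossing_adm f T C : crossing alpha f T -> adm Om alpha (fun x => T (C - V x)).
Proof.
move=> cT; split.
  exact: (crossing_comp_integrable domain_open domain_finite V_continuous_domain cT).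
by move=> x _; have [] := cT (C - V x).
Qed.

Variables (kappa : R -> R) (Phie me Ue : R -> R -> R).
Hypothesis reg : regularisation alpha s0 m U kappa Phie me Ue.
Variables (eps C : R).
Hypothesis eps01 : 0 < eps <= 1.

Let rho (x : 'rV[R]_d) := deriv_inv alpha (Ue eps) (C - V x).

Let rho_in x : 0 < rho x < alpha.
Proof. by have [] := deriv_inv_UeP std reg eps01 (C - V x). Qed.

Let rhoE x : derive1 (Ue eps) (rho x) = C - V x.
Proof. by have [] := deriv_inv_UeP std reg eps01 (C - V x). Qed.

Let cT := crossing_Ue std reg eps01.

(** rho is the composition of the C^2 function (Ue')^-1 with C - V. *)
Lemma stationary_C2 : Ck 2 Om (closure Om) rho.
Proof.
have CV : Ck 2 Om (closure Om) (cst C + cst (-1) * V).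
  apply: Ck_along_add; first exact: Ck_along_cst.
  by apply: Ck_along_mul; [exact: Ck_along_cst|exact: (sa_V_C2 std)].
have -> : rho = deriv_inv_jet alpha Ue eps 0 \o (cst C + cst (-1) * V).
  by apply/funext => x; rewrite /= !fctE mulN1r.
apply: Ck_along_comp CV.
- by move=> i z i2; exact: (deriv_inv_jetP std reg eps01).
- by move=> i i2; exact: (deriv_inv_jet_continuous std reg eps01).
Qed.

(** V is bounded, so C - V stays in a segment, whose image under the increasing
    (Ue')^-1 is a segment inside (0, alpha). *)
Lemma stationary_adm_pos : adm_pos Om alpha rho.
Proof.
split; first by have [] := crossing_adm C cT.
have [B B0 HB] := V_bounded.
pose l := deriv_inv alpha (Ue eps) (C - B); pose h := deriv_inv alpha (Ue eps) (C + B).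
have [la _] := deriv_inv_UeP std reg eps01 (C - B).
have [ha _] := deriv_inv_UeP std reg eps01 (C + B).
exists (Num.min l (alpha - h)).
  by rewrite lt_min subr_gt0; case/andP: la => -> _; case/andP: ha => _ ->.
move=> x Ox; have := HB x (subset_closure Ox); rewrite ler_norml => /andP[V1 V2].
have lx : l <= rho x by apply: crossing_le cT _; lra.
have hx : rho x <= h by apply: crossing_le cT _; lra.
rewrite ge_min lx/= lerBrDr.
have : Num.min l (alpha - h) <= alpha - h by rewrite ge_min lexx orbT.
lra.
Qed.

(** Ue'(rho) + V is the constant C, whose gradient vanishes. *)
Lemma stationary_classical : classical_solution Om alpha (me eps) (Ue eps) V rho (fun=> rho).
Proof.
have C2 := stationary_C2; have cr := Ck_along_continuous C2.
have flux0 : flux (me eps) (Ue eps) V rho = fun=> 0.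
  apply/funext => x; rewrite /flux.
  have -> : (fun y => derive1 (Ue eps) (rho y) + V y) = cst C.
    by apply/funext => y; rewrite rhoE subrK.
  suff -> : grad (cst C) x = 0 by rewrite scaler0.
  by apply/rowP => i; rewrite !mxE derive_cst.
rewrite /classical_solution/=; split.
- exact: (@within_continuous_snd _ _ [set t | 0 <= t]).
- split; first exact: (@Ck_along_snd_fst _ _ [set t | 0 < t]).
  exact: (@Ck_along_snd _ _ 2 [set t | 0 < t]).
- by move=> t x _ _; exact: rho_in.
- split=> // t x t0 Ox; rewrite derive1_cst flux0 /div big1// => i _.
  rewrite (_ : (fun y => _) = cst 0) ?derive_cst//.
  by apply/funext => y; rewrite mxE.
- move=> t x nu t0 bx onu; rewrite flux0.
  rewrite (_ : (fun y => _) = cst 0); first exact: cvg_cst.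
  by apply/funext => y; rewrite /dot big1// => i _; rewrite mxE mul0r.
Qed.

Let G (x : 'rV[R]_d) : 'rV[R]_d := - me eps (rho x) *: grad V x.

Let dV x v : Om x -> derivable V x v.
Proof.
by move=> Ox; have [_ /(_ v Logic.I)[H _]] := sa_V_C2 std; exact: H.
Qed.

(** By the chain rule the derivative is Phie'(rho) / Ue''(rho) times that of
    - V, and Phie'/Ue'' = me. *)
Lemma stationary_gradient i x : Om x ->
  is_derive x (basis_vec i) (Phie eps \o rho) (G x ord0 i).
Proof.
move=> Ox; have rx := rho_in x.
have dPhi : is_derive (rho x) (1 : R) (Phie eps) (derive1 (Phie eps) (rho x)).
  by apply: Ck_is_derive (rg_Phie_C3 reg eps01) _; rewrite /= in_itv.
have dCV : is_derive x (basis_vec i) (fun x => C - V x) (- 'D_(basis_vec i) V x).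
  have d1 := derivableP (@dV x (basis_vec i) Ox).
  by rewrite -sub0r; exact: is_deriveB.
have drho := @is_derive_comp _ _ _ (fun x => C - V x) _ _ _ _
  (is_derive_deriv_inv_Ue std reg eps01 (C - V x)) dCV.
have := is_derive_comp dPhi drho.
suff -> : derive1 (Phie eps) (rho x) * ((derive1n 2 (Ue eps) (rho x))^-1 *
   - 'D_(basis_vec i) V x) = G x ord0 i by [].
rewrite (rg_Ue'' reg eps01 rx) !mxE invf_div mulrA.
rewrite [X in X * _]mulrCA mulfV ?mulr1 ?mulrN ?mulNr//.
by rewrite gt_eqF// (lt_le_trans _ (Phie'_ge std reg eps01 rx))//; case/andP: eps01.
Qed.

Lemma stationary_gradient_ext i : exists2 g : 'rV[R]_d -> R,
  {within closure Om, continuous g} & forall x, Om x -> g x = G x ord0 i.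
Proof.
have [_ /(_ (basis_vec i) Logic.I)[_ [gV [gVE [cgV _]]]]] := sa_V_C2 std.
have crho := Ck_along_continuous stationary_C2.
exists (fun x => - me eps (rho x) * gV x) => [|x Ox]; last first.
  by rewrite gVE// !mxE.
suff cmr : {within closure Om, continuous (me eps \o rho)}.
  by move=> x; apply: cvgM; [apply: cvgN; exact: cmr|exact: cgV].
apply: within_continuous_comp crho _ => x _.
apply: is_derive_continuous; apply: Ck_is_derive (rg_me_C1 reg eps01) _.
by rewrite /= in_itv; exact: rho_in.
Qed.

(** With G = - me(rho) grad V the flux G + me(rho) grad V is zero, so the weak
    formulation reduces to G being the weak gradient of Phie(rho). *)
Lemma stationary_weak : weak_solution Om alpha (me eps) (Phie eps) V rho (fun=> rho).
Proof.
have oO := domain_open; have mO := open_measurable_rV oO.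
have sub := @subset_closure _ Om.
have crho := Ck_along_continuous stationary_C2.
have cGO i : {within Om, continuous (fun x => G x ord0 i)}.
  have [g cg gE] := stationary_gradient_ext i.
  apply: subspace_eq_continuous (continuous_subspaceW sub cg).
  by move=> x /set_mem; exact: gE.
have mG i : measurable_fun Om (fun x => G x ord0 i).
  exact: continuous_measurable_rV.
have cPr : {within closure Om, continuous (Phie eps \o rho)}.
  apply: within_continuous_comp crho _ => x _.
  apply: is_derive_continuous; apply: Ck_is_derive (rg_Phie_C3 reg eps01) _.
  by rewrite /= in_itv; exact: rho_in.
split.
- by move=> t _; exact: crossing_adm C cT.
- exact: ae_eq_refl.
- move=> t _; rewrite (_ : (fun s => _) = cst 0%E); last first.
    apply/funext => s; rewrite /L1dist /L1norm; apply: integral0_eq => x _.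
    by rewrite subrr normr0.
  exact: cvg_cst.
- exists (fun=> G); split.
  + move=> i; apply: (measurable_comp mO (g := snd) (f := fun x => G x ord0 i)).
    * by move=> _ [[t x] [_ Ox] <-].
    * exact: mG.
    * exact: measurable_funTS.
  + apply: aeW => t _ i psi tpsi.
    apply: integration_by_parts_test => //.
    * exact: domain_finite.
    * exact: continuous_subspaceW sub cPr.
    * by move=> x Ox; exact: stationary_gradient.
  + move=> T T0.
    have [BP _ HBP] := compact_continuous_bounded closure_domain_compact cPr.
    have [BG HBG] : exists BG : 'I_d -> R, forall i x, Om x -> `|G x ord0 i| <= BG i.
      suff /choice[BG H] : forall i, exists B : R, forall x, Om x -> `|G x ord0 i| <= B.
        by exists BG.
      move=> i; have [g cg gE] := stationary_gradient_ext i.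
      have [B _ HB] := compact_continuous_bounded closure_domain_compact cg.
      by exists B => x Ox; rewrite -gE// HB//; exact: sub.
    pose q x := Phie eps (rho x) ^+ 2 + dot (G x) (G x).
    have q0 x : 0 <= q x.
      by rewrite addr_ge0 ?sqr_ge0// sumr_ge0// => i _; rewrite -expr2 sqr_ge0.
    have iq : mu.-integrable Om (EFin \o q).
      apply: (bounded_integrable (B := BP ^+ 2 + \sum_i BG i ^+ 2)) => //.
      * exact: domain_finite.
      * apply: measurable_funD.
          apply: measurable_funX; apply: continuous_measurable_rV oO _.
          exact: continuous_subspaceW sub cPr.
        by apply: measurable_sum => i; apply: measurable_funM.
      * move=> x Ox; rewrite ger0_norm// lerD//.
          rewrite -real_normK ?num_real// ler_sqr ?nnegrE//; first exact/HBP/sub.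
          by apply: le_trans (HBP _ (sub _ Ox)).
        apply: ler_sum => i _; rewrite -expr2 -real_normK ?num_real//.
        rewrite ler_sqr ?nnegrE//; first exact: HBG.
        by apply: le_trans (HBG i _ Ox).
    have fI : (\int[mu]_(x in Om) (q x)%:E)%E \is a fin_num by exact: integrable_fin_num.
    have I0 : (0 <= \int[mu]_(x in Om) (q x)%:E)%E.
      by apply: integral_ge0 => x _; rewrite lee_fin.
    have := @integral_cst _ _ _ (@lebesgue_measure R) (`]0, T[ : set R) ltac:(exact: measurable_itv)
      (\int[mu]_(x in Om) (q x)%:E)%E.
    rewrite /cst/= => ->; apply: lte_mul_pinfty => //.
    by rewrite lebesgue_measure_itv/= lte_fin T0 ltry.
  + move=> phi t _ _; rewrite subrr.
    have H x : dot (G x + me eps (rho x) *: grad V x) (grad phi x) = 0.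
      by rewrite /G scaleNr addNr /dot big1// => i _; rewrite mxE mul0r.
    apply/esym/eqP; rewrite oppr_eq0; apply/eqP.
    rewrite (@eq_Rintegral _ _ _ _ _ (cst 0)) ?Rintegral_cst ?mul0r//.
    move=> s _; rewrite (@eq_Rintegral _ _ _ _ _ (cst 0)) ?Rintegral_cst ?mul0r//.
Qed.

End stationary.
(** * Minimisers of the free energy *)

Section L1_distance.
Context {R : realType} {d : nat}.
Variables (Om : set 'rV[R]_d) (alpha : R).
Hypotheses (oOm : open Om) (Omoo : (lebesgue_rV d Om < +oo)%E).
Local Notation mu := (@lebesgue_rV R d).
Implicit Types rho eta zeta : 'rV[R]_d -> R.

Let mOm : measurable Om. Proof. exact: open_measurable_rV. Qed.

Lemma adm_measurable rho : adm Om alpha rho -> measurable_fun Om rho.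
Proof. by move=> [/measurable_int/measurable_EFinP]. Qed.

Lemma adm_L1norm rho : adm Om alpha rho ->
  L1norm Om rho = (\int[mu]_(x in Om) rho x)%:E.
Proof.
move=> [irho rho0]; rewrite /Rintegral fineK; last exact: integrable_fin_num.
apply: eq_integral => x /set_mem Ox; rewrite ger0_norm//.
by have /andP[] := rho0 _ Ox.
Qed.

Lemma adm_convex t rho eta : 0 <= t <= 1 -> adm Om alpha rho -> adm Om alpha eta ->
  adm Om alpha (fun x => (1 - t) * rho x + t * eta x).
Proof.
move=> t01 Arho Aeta.
have B x : Om x -> 0 <= (1 - t) * rho x + t * eta x <= alpha.
  move=> Ox; have [_ /(_ _ Ox)/andP[r0 ra]] := Arho.
  have [_ /(_ _ Ox)/andP[e0 ea]] := Aeta; apply/andP; split.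
    by rewrite addr_ge0// mulr_ge0//; lra.
  rewrite (_ : alpha = (1 - t) * alpha + t * alpha); last by rewrite -mulrDl subrK mul1r.
  by rewrite lerD// ler_wpM2l//; lra.
split=> //; apply: (bounded_integrable (B := alpha)) => //.
  apply: measurable_funD; apply: measurable_funM => //.
    exact: adm_measurable Arho.
  exact: adm_measurable Aeta.
by move=> x Ox; have /andP[H1 H2] := B _ Ox; rewrite ger0_norm.
Qed.

Lemma L1dist_triangle rho eta zeta : adm Om alpha rho -> adm Om alpha eta ->
  adm Om alpha zeta -> (L1dist Om rho zeta <= L1dist Om rho eta + L1dist Om eta zeta)%E.
Proof.
move=> /adm_measurable mr /adm_measurable me /adm_measurable mz.
have m2 (f g : 'rV[R]_d -> R) : measurable_fun Om f -> measurable_fun Om g ->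
    measurable_fun Om (fun x => `|f x - g x|%:E).
  move=> mf mg; apply/measurable_EFinP; apply: measurableT_comp => //.
  exact: measurable_funB.
rewrite /L1dist /L1norm -ge0_integralD//; try exact: m2.
apply: ge0_le_integral => //; try exact: m2.
- by apply: emeasurable_funD; exact: m2.
- by move=> x _; rewrite -EFinD lee_fin ler_distD.
Qed.

Lemma L1dist_eq0 rho eta : adm Om alpha rho -> adm Om alpha eta ->
  L1dist Om rho eta = 0%E -> ae_eq mu Om rho eta.
Proof.
move=> /adm_measurable mr /adm_measurable me H.
have : ae_eq mu Om (EFin \o (fun x => rho x - eta x)) (cst 0%E).
  apply/(ae_eq_integral_abs _ mOm); last by [].
  by apply/measurable_EFinP; exact: measurable_funB.
apply: filterS => x Hx Ox; have [/eqP] := Hx Ox.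
by rewrite subr_eq0 => /eqP.
Qed.

Lemma ae_eq_L1dist0 rho eta : adm Om alpha rho -> adm Om alpha eta ->
  ae_eq mu Om rho eta -> L1dist Om rho eta = 0%E.
Proof.
move=> /adm_measurable mr /adm_measurable me H.
have : ae_eq mu Om (EFin \o (fun x => rho x - eta x)) (cst 0%E).
  by apply: filterS H => x Hx Ox; rewrite /= (Hx Ox) subrr.
move/(ae_eq_integral_abs _ mOm); apply.
by apply/measurable_EFinP; exact: measurable_funB.
Qed.

End L1_distance.

Section minimiser.
Context {R : realType} {d : nat}.
Variables (Om : set 'rV[R]_d) (alpha s0 : R) (m U : R -> R) (V : 'rV[R]_d -> R).
Hypothesis std : standing_assumptions Om alpha s0 m U V.
Hypothesis U''_gt0 : {ae lebesgue_measure, forall s : R,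
    0 < s < alpha -> 0 < derive1n 2 U s}.
Local Notation mu := (@lebesgue_rV R d).
Implicit Types rho eta : 'rV[R]_d -> R.

Let oO := domain_open std.
Let Ooo := domain_finite std.
Let mO := open_measurable_rV oO.
Let cV := V_continuous_domain std.
Let cT := crossing_U std U''_gt0.
Local Notation T := (trunc_deriv_inv alpha U).

Lemma U_comp_integrable rho : adm Om alpha rho ->
  mu.-integrable Om (EFin \o (U \o rho)).
Proof.
move=> Arho; have [B _ HB] := compact_continuous_bounded (@segment_compact R 0 alpha) (sa_U_C0 std).
apply: (bounded_integrable (B := B)) => //.
  have mI : measurable ((`[0, alpha] : set R) : set (measurableTypeR R)).
    by apply: compact_measurable; exact: segment_compact.
  apply: (measurable_comp mI) => //.
  - by move=> _ [x Ox <-]; rewrite /= in_itv/=; have [_ ->] := Arho.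
  - exact: subspace_continuous_measurable_fun (sa_U_C0 std).
  - exact: adm_measurable Arho.
by move=> x Ox; apply: HB; rewrite /= in_itv/=; have [_ ->] := Arho.
Qed.

Lemma V_mul_integrable rho : adm Om alpha rho ->
  mu.-integrable Om (EFin \o (fun x => V x * rho x)).
Proof.
move=> Arho; have [B B0 HB] := V_bounded std.
apply: (bounded_integrable (B := B * alpha)) => //.
  apply: measurable_funM; first exact: continuous_measurable_rV.
  exact: adm_measurable Arho.
move=> x Ox; rewrite normrM ler_pM ?HB//; first exact: subset_closure.
by have [_ /(_ _ Ox)/andP[r0 ra]] := Arho; rewrite ger0_norm.
Qed.

Definition real_energy rho : R :=
  \int[mu]_(x in Om) U (rho x) + \int[mu]_(x in Om) (V x * rho x).

Lemma free_energyE rho : adm Om alpha rho ->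
  free_energy Om U V rho = (real_energy rho)%:E.
Proof.
move=> Arho; rewrite /free_energy /real_energy EFinD /Rintegral !fineK//.
  by apply: integrable_fin_num => //; exact: V_mul_integrable.
by apply: integrable_fin_num => //; exact: U_comp_integrable.
Qed.

Variables (C M : R).
Local Notation rho0 := (fun x => T (C - V x)).
Hypothesis massC : \int[mu]_(x in Om) rho0 x = M.

Let Arho0 : adm Om alpha rho0. Proof. exact: (crossing_adm std C cT). Qed.

Lemma adm_massP eta : adm_mass Om alpha M eta <->
  adm Om alpha eta /\ \int[mu]_(x in Om) eta x = M.
Proof.
split=> -[Aeta]; last by move=> E; split => //; rewrite (adm_L1norm oO Aeta) E.
by rewrite (adm_L1norm oO Aeta) => -[].
Qed.

Let excess eta x := (U (eta x) - (C - V x) * eta x) - (U (rho0 x) - (C - V x) * rho0 x).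

Let dU c : 0 < c < alpha -> derivable U c 1.
Proof. by move=> ca; have [] := U_is_derive std ca. Qed.

Let excess_ge0 eta x : adm Om alpha eta -> Om x -> 0 <= excess eta x.
Proof.
move=> [_ Aeta] Ox; rewrite subr_ge0.
have [->//|ne] := eqVneq (eta x) (rho0 x).
by apply/ltW/(crossing_lt_min cT (sa_U_C0 std) dU (Aeta _ Ox) ne).
Qed.

Let excess_eq0 eta x : adm Om alpha eta -> Om x -> excess eta x = 0 -> eta x = rho0 x.
Proof.
move=> [_ Aeta] Ox; have [//|ne] := eqVneq (eta x) (rho0 x).
have := crossing_lt_min cT (sa_U_C0 std) dU (Aeta _ Ox) ne.
by rewrite -subr_gt0 -/(excess eta x) => /[swap] ->; rewrite ltxx.
Qed.

Let energy_density_integrable eta : adm Om alpha eta ->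
  mu.-integrable Om (EFin \o (fun x => U (eta x) - (C - V x) * eta x)) /\
  \int[mu]_(x in Om) (U (eta x) - (C - V x) * eta x) =
  real_energy eta - C * \int[mu]_(x in Om) eta x.
Proof.
move=> Aeta; have iU := U_comp_integrable Aeta; have iV := V_mul_integrable Aeta.
have [ie _] := Aeta.
have iC : mu.-integrable Om (EFin \o (fun x => C * eta x)).
  exact: (integrableZl mO C ie).
have iUV : mu.-integrable Om (EFin \o (fun x => U (eta x) + V x * eta x)).
  exact: (integrable_realD mO iU iV).
have E : (fun x => U (eta x) - (C - V x) * eta x) =
    (fun x => (U (eta x) + V x * eta x) - C * eta x).
  by apply/funext => x; rewrite mulrBl opprB addrA.
rewrite E; split; first exact: (integrable_realB mO iUV iC).
by rewrite RintegralB// RintegralD// RintegralZl.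
Qed.

(** The term C rho of the density integrates to C M for both functions and
    cancels. *)
Lemma excess_integral eta : adm_mass Om alpha M eta ->
  (\int[mu]_(x in Om) `|(excess eta x)%:E| = (real_energy eta - real_energy rho0)%:E)%E.
Proof.
move=> /adm_massP[Aeta Meta].
have [i1 E1] := energy_density_integrable Aeta.
have [i2 E2] := energy_density_integrable Arho0.
have -> : (\int[mu]_(x in Om) `|(excess eta x)%:E| = \int[mu]_(x in Om) (excess eta x)%:E)%E.
  by apply: eq_integral => x /set_mem Ox; rewrite gee0_abs// lee_fin excess_ge0.
have -> : real_energy eta - real_energy rho0 = \int[mu]_(x in Om) excess eta x.
  by rewrite RintegralB// E1 E2 Meta massC opprB addrA subrK.
rewrite /Rintegral fineK//; apply: integrable_fin_num => //.
exact: (integrable_realB mO i1 i2).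
Qed.

Lemma real_energy_ge eta : adm_mass Om alpha M eta -> real_energy rho0 <= real_energy eta.
Proof.
move=> Meta; rewrite -subr_ge0 -lee_fin -(excess_integral Meta).
exact: integral_ge0.
Qed.

Lemma real_energy_le_ae_eq eta : adm_mass Om alpha M eta ->
  real_energy eta <= real_energy rho0 -> ae_eq mu Om eta rho0.
Proof.
move=> Meta; have := real_energy_ge Meta => H1 H2.
have Aeta := (adm_massP eta).1 Meta.
have [i1 _] := energy_density_integrable Aeta.1.
have [i2 _] := energy_density_integrable Arho0.
have : ae_eq mu Om (EFin \o excess eta) (cst 0%E).
  apply/(ae_eq_integral_abs _ mO).
    by apply: measurable_int; exact: (integrable_realB mO i1 i2).
  rewrite (excess_integral Meta).
  by congr (_%:E); apply/eqP; rewrite subr_eq0 eq_le H1 H2.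
apply: filterS => x Hx Ox; apply: excess_eq0 => //; first exact: Aeta.1.
by case: (Hx Ox).
Qed.

Lemma real_energy_convex t eta : 0 < t < 1 -> adm Om alpha eta ->
  real_energy (fun x => (1 - t) * eta x + t * rho0 x) <=
  (1 - t) * real_energy eta + t * real_energy rho0.
Proof.
move=> t01 Aeta.
have At : adm Om alpha (fun x => (1 - t) * eta x + t * rho0 x).
  by apply: (adm_convex oO Ooo _ Aeta Arho0); lra.
have iZ c (f : 'rV[R]_d -> R) : mu.-integrable Om (EFin \o f) ->
    mu.-integrable Om (EFin \o (fun x => c * f x)).
  by move=> fi; exact: (integrableZl mO c fi).
have i1 := U_comp_integrable Aeta; have i2 := U_comp_integrable Arho0.
have j1 := V_mul_integrable Aeta; have j2 := V_mul_integrable Arho0.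
rewrite /real_energy !mulrDr [leRHS]addrACA lerD//.
  rewrite -!RintegralZl// -RintegralD//; try exact: iZ.
  apply: le_Rintegral => //; first exact: U_comp_integrable At.
    by apply: integrable_realD => //; exact: iZ.
  move=> x Ox; apply: (convex_derive_le (sa_U_C0 std) dU) => //.
  - move=> c e ca ea ce; apply/ltW.
    apply: (ae_pos_derive_lt (df := derive1n 2 U) _ _ U''_gt0 ca ea ce).
      exact: (U'_is_derive std).
    exact: (sa_U_convex std).
  - by have [_ ->] := Aeta.
  - by have [_ ->] := Arho0.
rewrite -!RintegralZl// -RintegralD//; try exact: iZ.
rewrite (_ : (fun x => V x * _) = (fun x => (1 - t) * (V x * eta x) + t * (V x * rho0 x)))//.
by apply/funext => x; rewrite mulrDr !(mulrCA (V x)).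
Qed.

Lemma rho0_adm_mass : adm_mass Om alpha M rho0.
Proof. by apply/adm_massP. Qed.

Lemma global_minimiser_rho0 :
  ae_unique Om (global_minimiser (free_energy Om U V) (adm_mass Om alpha M)) rho0.
Proof.
split; [split|].
- exact: rho0_adm_mass.
- move=> eta Meta; have [Aeta _] := Meta.
  by rewrite !free_energyE// lee_fin real_energy_ge.
- move=> eta [Meta /(_ _ rho0_adm_mass)]; have [Aeta _] := Meta.
  by rewrite !free_energyE// lee_fin; exact: real_energy_le_ae_eq.
Qed.

(** Along the segment from a local minimiser eta to the global one, convexity
    bounds the energy by the interpolated energies; since eta is minimal among
    the nearby points of the segment, its energy cannot exceed the global
    minimum. *)
Lemma L1_local_minimiser_rho0 :
  ae_unique Om (L1_local_minimiser Om (free_energy Om U V) (adm_mass Om alpha M)) rho0.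
Proof.
have [[Mrho0 gmin] _] := global_minimiser_rho0.
split; [split=> //|].
  by exists 1 => // eta Meta _; exact: gmin.
move=> eta [Meta [delta delta0 lmin]].
have [Aeta Leta] := Meta.
apply: real_energy_le_ae_eq => //.
pose K := alpha * fine (mu Om).
have a0 := sa_alpha std.
have K0 : 0 <= K by apply: mulr_ge0; [exact: ltW|exact: fine_ge0].
(* The L^1 distance from eta to the point of parameter t is at most t K. *)
pose t := delta / (K + delta + delta).
have t01 : 0 < t < 1.
  by rewrite /t divr_gt0 ?ltr_pdivrMr; lra.
pose etat x := (1 - t) * eta x + t * rho0 x.
have At : adm Om alpha etat by apply: (adm_convex oO Ooo _ Aeta Arho0); lra.
have Mt : adm_mass Om alpha M etat.
  apply/adm_massP; split => //.
  have /adm_massP[_ Meta'] := Meta.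
  have [ie _] := Aeta; have [ir _] := Arho0.
  rewrite RintegralD//; [|exact: (integrableZl mO (1 - t) ie)|exact: (integrableZl mO t ir)].
  by rewrite !RintegralZl// massC Meta' -mulrDl subrK mul1r.
have dt : (L1dist Om etat eta < delta%:E)%E.
  rewrite /L1dist /L1norm.
  have H x : Om x -> `|etat x - eta x| <= t * alpha.
    move=> Ox; have -> : etat x - eta x = t * (rho0 x - eta x) by rewrite /etat; lra.
    rewrite normrM ger0_norm; last by lra.
    rewrite ler_wpM2l//; first by lra.
    have [_ /(_ _ Ox)] := Aeta; have [_ /(_ _ Ox)] := Arho0.
    by rewrite ler_norml; lra.
  apply: (@le_lt_trans _ _ (\int[mu]_(x in Om) (t * alpha)%:E)%E).
    apply: ge0_le_integral => //.
    apply/measurable_EFinP; apply: measurableT_comp => //.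
    by apply: measurable_funB; [exact: adm_measurable At|exact: adm_measurable Aeta].
  have -> : (\int[mu]_(x in Om) (t * alpha)%:E = (t * alpha * fine (mu Om))%:E)%E.
    rewrite -(Rintegral_cst mu mO) /Rintegral fineK//; apply: integrable_fin_num => //.
    exact: (bounded_integrable (f := cst (t * alpha)) (B := `|t * alpha|)).
  rewrite lte_fin -mulrA -/K /t mulrAC ltr_pdivrMr; last by lra.
  by rewrite ltr_pM2l//; lra.
have := lmin _ Mt dt; rewrite !free_energyE// lee_fin => E1.
have := real_energy_convex t01 Aeta; rewrite -/etat => E2.
have : t * real_energy eta <= t * real_energy rho0 by lra.
by rewrite ler_pM2l//; lra.
Qed.

End minimiser.
(** * The limit of vanishing regularisation *)

Section convergence.
Context {R : realType} {d : nat}.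
Variables (Om : set 'rV[R]_d) (alpha s0 : R) (m U : R -> R) (V : 'rV[R]_d -> R).
Hypothesis std : standing_assumptions Om alpha s0 m U V.
Hypothesis U''_gt0 : {ae lebesgue_measure, forall s : R,
    0 < s < alpha -> 0 < derive1n 2 U s}.
Variables (kappa : R -> R) (Phie me Ue : R -> R -> R).
Hypothesis reg : regularisation alpha s0 m U kappa Phie me Ue.
Local Notation mu := (@lebesgue_rV R d).

Lemma Ue'_cvg_seq (e_ : nat -> R) c : (forall k, 0 < e_ k) ->
  e_ k @[k --> \oo] --> 0 -> 0 < c < alpha ->
  derive1 (Ue (e_ k)) c @[k --> \oo] --> derive1 U c.
Proof.
move=> e0 ecv ca; have := Ue'_cvg std reg ca.
by move/cvg_at_rightP => /(_ e_ (conj e0 ecv)).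
Qed.

(** S_t rho0 is compared with rho0 through Se_t rho0, Se_t rho_k and
    rho_k = Se_t rho_k, where rho_k is the regularised state at the same level.
    Contractivity bounds the second step by the distance from rho_k to rho0,
    which also is the last step. *)
Lemma limit_semigroup_fixed (epsk : nat -> R)
    (Se : R -> R -> ('rV[R]_d -> R) -> 'rV[R]_d -> R)
    (S : R -> ('rV[R]_d -> R) -> 'rV[R]_d -> R) (C t : R) :
  (forall eps : R, 0 < eps <= 1 ->
    regularised_semigroup Om alpha V (me eps) (Ue eps) (Se eps)) ->
  limit_semigroup Om alpha s0 m U V epsk Se S -> 0 < t ->
  ae_eq mu Om (S t (fun x => trunc_deriv_inv alpha U (C - V x)))
    (fun x => trunc_deriv_inv alpha U (C - V x)).
Proof.
move=> semi_eps [[Sadm _ _] _ ek01 ekcv Scv] t0.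
have oO := domain_open std; have Ooo := domain_finite std.
have cV := V_continuous_domain std; have cT := crossing_U std U''_gt0.
pose rho0 x := trunc_deriv_inv alpha U (C - V x).
pose rho_ k x := deriv_inv alpha (Ue (epsk k)) (C - V x).
have cTk k : crossing alpha (derive1 (Ue (epsk k))) (deriv_inv alpha (Ue (epsk k))).
  exact: (crossing_Ue std reg (ek01 k)).
have A0 : adm Om alpha rho0 by exact: (crossing_adm std C cT).
have Ak k : adm Om alpha (rho_ k) by exact: (crossing_adm std C (cTk k)).
have AS := Sadm t rho0 (ltW t0) A0.
have rho_cvg : L1dist Om (rho_ k) rho0 @[k --> \oo] --> 0%E.
  apply: (crossing_comp_cvg oO Ooo cV cTk cT _ (cvg_cst C)).1 => c ca.
  by apply: Ue'_cvg_seq => // k; case/andP: (ek01 k).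
apply: (L1dist_eq0 oO AS A0); apply/eqP; rewrite eq_le; apply/andP; split; last first.
  exact: integral_ge0.
apply/lee_addgt0Pr => e e0; rewrite add0e.
have e4 : 0 < e / 4 by rewrite divr_gt0.
have near1 : \forall k \near \oo, (L1dist Om (rho_ k) rho0 < (e / 4)%:E)%E.
  move/fine_cvgP : rho_cvg => [fin cv].
  apply: filterS (filterI fin (cvgr_lt _ cv _ e4)) => k [fk lk].
  by rewrite -(fineK fk) lte_fin; exact: lk.
have near2 := Scv rho0 t (e / 4) A0 e4.
have [k [Hk1 Hk2]] : exists k, (L1dist Om (rho_ k) rho0 < (e / 4)%:E)%E /\
    (forall s, 0 <= s <= t -> (L1dist Om (Se (epsk k) s rho0) (S s rho0) <= (e / 4)%:E)%E).
  by have [k] := filter_ex (filterI near1 near2); exists k.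
have [[Seadm _ _] _ Secontr Seext] := semi_eps _ (ek01 k).
have stat : ae_eq mu Om (Se (epsk k) t (rho_ k)) (rho_ k).
  apply: (Seext (rho_ k) (fun=> rho_ k)) (ltW t0).
  - exact: (stationary_adm_pos std reg C (ek01 k)).
  - exact: (stationary_C2 std reg C (ek01 k)).
  - exact: (stationary_classical std reg C (ek01 k)).
have B0 := Seadm t rho0 (ltW t0) A0; have Bk := Seadm t (rho_ k) (ltW t0) (Ak k).
have sym f g : L1dist Om f g = L1dist Om g f.
  by apply: eq_integral => x _; rewrite distrC.
have T3 := L1dist_triangle oO Bk (Ak k) A0.
rewrite (ae_eq_L1dist0 oO Bk (Ak k) stat) add0e in T3.
have contr : (L1dist Om (Se (epsk k) t rho0) (Se (epsk k) t (rho_ k)) <= (e / 4)%:E)%E.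
  by apply: (le_trans (Secontr t rho0 (rho_ k) (ltW t0) A0 (Ak k))); rewrite sym ltW.
have near_S : (L1dist Om (S t rho0) (Se (epsk k) t rho0) <= (e / 4)%:E)%E.
  by rewrite sym; apply: Hk2; rewrite lexx ltW.
apply: (le_trans (L1dist_triangle oO AS B0 A0)).
apply: (le_trans (leeD near_S (le_trans (L1dist_triangle oO B0 Bk A0)
  (leeD contr (le_trans T3 (ltW Hk1)))))).
by rewrite -!EFinD lee_fin; lra.
Qed.

(** The level Ce eps is fixed by the mass of the regularised state, and its
    convergence has to be shown before that of the states. *)
Lemma stationary_L1_cvg M C0 (Ce : R -> R) :
  \int[mu]_(x in Om) trunc_deriv_inv alpha U (C0 - V x) = M ->
  (forall C, \int[mu]_(x in Om) trunc_deriv_inv alpha U (C - V x) = M -> C = C0) ->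
  (forall eps, 0 < eps <= 1 ->
     \int[mu]_(x in Om) deriv_inv alpha (Ue eps) (Ce eps - V x) = M) ->
  L1dist Om (fun x => deriv_inv alpha (Ue eps) (Ce eps - V x))
    (fun x => trunc_deriv_inv alpha U (C0 - V x)) @[eps --> 0^'+] --> 0%E.
Proof.
move=> MC0 uniq MCe; apply/cvge_at_rightP => u [u0 ucv].
have oO := domain_open std; have Ooo := domain_finite std.
have cV := V_continuous_domain std; have cT := crossing_U std U''_gt0.
(* The regularised problem is only given for eps <= 1; the sequence u is
   truncated, which changes finitely many terms. *)
pose v k := Num.min (u k) 1.
have v01 k : 0 < v k <= 1 by rewrite lt_min u0 ltr01/= ge_min lexx orbT.
have uv : \forall k \near \oo, v k = u k.
  near=> k; apply/min_idPl/ltW; near: k.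
  by apply: cvgr_lt ucv _ _; exact: ltr01.
have vcv : v k @[k --> \oo] --> 0.
  apply: cvg_trans ucv; apply: near_eq_cvg; apply: filterS uv => k.
  exact: esym.
have cTk k : crossing alpha (derive1 (Ue (v k))) (deriv_inv alpha (Ue (v k))).
  exact: (crossing_Ue std reg (v01 k)).
have Uv c : 0 < c < alpha -> derive1 (Ue (v k)) c @[k --> \oo] --> derive1 U c.
  by move=> ca; apply: Ue'_cvg_seq => // k; case/andP: (v01 k).
have Ccv : Ce (v k) @[k --> \oo] --> C0.
  by apply: (mass_level_cvg oO Ooo cV cTk cT Uv (M := M)) => // k; exact: MCe.
have [H _] := crossing_comp_cvg oO Ooo cV cTk cT Uv Ccv.
apply: cvg_trans H; apply: near_eq_cvg; apply: filterS uv => k -> //.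
Unshelve. all: by end_near. Qed.

End convergence.

Theorem theorem2p10 (R : realType) (d : nat) (Om : set 'rV[R]_d)
  (alpha s0 M : R) (m U : R -> R) (V : 'rV[R]_d -> R)
  (kappa : R -> R) (Phie me Ue : R -> R -> R)
  (Se : R -> R -> ('rV[R]_d -> R) -> 'rV[R]_d -> R)
  (epsk : nat -> R) (S : R -> ('rV[R]_d -> R) -> 'rV[R]_d -> R)
  (d_gt0 : (0 < d)%N)
  (std : standing_assumptions Om alpha s0 m U V)
  (reg : regularisation alpha s0 m U kappa Phie me Ue)
  (semi_eps : forall eps : R, 0 < eps <= 1 ->
    regularised_semigroup Om alpha V (me eps) (Ue eps) (Se eps))
  (semi : limit_semigroup Om alpha s0 m U V epsk Se S)
  (U''_gt0 : {ae lebesgue_measure, forall s : R,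
    0 < s < alpha -> 0 < derive1n 2 U s})
  (M_range : (0 < M%:E < alpha%:E * lebesgue_rV d Om)%E) :
  let rho0 (C : R) (x : 'rV[R]_d) := trunc_deriv_inv alpha U (C - V x) in
  let rhoe (eps C : R) (x : 'rV[R]_d) := deriv_inv alpha (Ue eps) (C - V x) in
  let mass (rho : 'rV[R]_d -> R) :=
    (\int[lebesgue_rV d]_(x in Om) (rho x)%:E)%E in
  exists C0 : R,
    unique (fun C => mass (rho0 C) = M%:E) C0 /\
    [/\ forall t : R, 0 < t ->
          ae_eq (lebesgue_rV d) Om (S t (rho0 C0)) (rho0 C0),
        ae_unique Om
          (L1_local_minimiser Om (free_energy Om U V) (adm_mass Om alpha M))
          (rho0 C0) /\
        ae_unique Om
          (global_minimiser (free_energy Om U V) (adm_mass Om alpha M))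
          (rho0 C0)
      & 0 < inf [set derive1n 2 U s | s in `]0, alpha[] ->
        exists Ce : R -> R,
          [/\ forall eps : R, 0 < eps <= 1 ->
                unique (fun C => mass (rhoe eps C) = M%:E) (Ce eps),
              forall eps : R, 0 < eps <= 1 ->
                weak_solution Om alpha (me eps) (Phie eps) V
                  (rhoe eps (Ce eps)) (fun=> rhoe eps (Ce eps))
            & L1dist Om (rhoe eps (Ce eps)) (rho0 C0)
                @[eps --> 0^'+] --> 0%E]].
Proof.
move=> rho0 rhoe mass.
have a0 := sa_alpha std.
have oO := domain_open std; have Ooo := domain_finite std.
have cV := V_continuous_domain std; have cT := crossing_U std U''_gt0.
have connO : connected Om by case: (sa_domain std).
have /andP[M0 Ma] := M_range; rewrite lte_fin in M0.
have [C0 JC0] := mass_exists oO Ooo cV a0 cT M0 Ma.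
have uniqC0 C : \int[lebesgue_rV d]_(x in Om) rho0 C x = M -> C = C0.
  move=> JC; apply: (mass_inj oO Ooo cV a0 connO cT (U'_continuous std) M0 Ma JC JC0).
have massE C : mass (rho0 C) = (\int[lebesgue_rV d]_(x in Om) rho0 C x)%:E.
  exact: (mass_Rintegral oO Ooo cV cT).
exists C0; split.
  split; first by rewrite massE JC0.
  by move=> C; rewrite massE => -[/uniqC0].
split.
- by move=> t t0; exact: (limit_semigroup_fixed std U''_gt0 reg C0 semi_eps semi t0).
- split; first exact: (L1_local_minimiser_rho0 std U''_gt0 JC0).
  exact: (global_minimiser_rho0 std U''_gt0 JC0).
- move=> _.
  have massEe eps C : 0 < eps <= 1 ->
      mass (rhoe eps C) = (\int[lebesgue_rV d]_(x in Om) rhoe eps C x)%:E.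
    move=> e01; exact: (mass_Rintegral oO Ooo cV (crossing_Ue std reg e01)).
  have /choice[Ce HCe] : forall eps, exists C, 0 < eps <= 1 ->
      \int[lebesgue_rV d]_(x in Om) rhoe eps C x = M.
    move=> eps; have [e01|e01] := boolP (0 < eps <= 1); last by exists 0.
    have [C JC] := mass_exists oO Ooo cV a0 (crossing_Ue std reg e01) M0 Ma.
    by exists C.
  exists Ce; split.
  + move=> eps e01; split; first by rewrite massEe// HCe.
    move=> C; rewrite massEe// => -[JC].
    exact: (mass_inj oO Ooo cV a0 connO (crossing_Ue std reg e01)
      (Ue'_continuous reg e01) M0 Ma (HCe _ e01) JC).
  + by move=> eps e01; exact: (stationary_weak std reg (Ce eps) e01).
  + exact: (stationary_L1_cvg std U''_gt0 reg JC0 uniqC0 HCe).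
Qed.
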